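(* (a) The pair $(\mathrm{des},\mathrm{comaj})$ is shuffle-compatible. (b) The linear map on $\mathcal{A}_{(\mathrm{des},\mathrm{comaj})}$ defined by $[\pi]\mapsto q^{\mathrm{comaj}(\pi)}\binom{p-\mathrm{des}(\pi)+|\pi|-1}{|\pi|}_q x^{|\pi|}$ is a $\mathbb{Q}$-algebra isomorphism from $\mathcal{A}_{(\mathrm{des},\mathrm{comaj})}$ to the span of $\{1\}\cup\{q^k\binom{p-j+n-1}{n}_q x^n\}_{n\ge1,\,0\le j\le n-1,\,\binom{j+1}{2}\le k\le nj-\binom{j+1}2}$, a subalgebra of $\mathbb{Q}[q,x]^{\mathbb{N}}$, the algebra (with pointwise operations) of functions $\mathbb{N}\to\mathbb{Q}[q,x]$ of the nonnegative integer variable $p$. (c) The linear map defined by $[\pi]\mapsto \frac{q^{\mathrm{comaj}(\pi)}t^{\mathrm{des}(\pi)+1}}{(1-t)(1-qt)\cdots(1-q^{|\pi|}t)}x^{|\pi|}$ if $|\pi|\ge1$ and $[\pi]\mapsto 1/(1-t)$ if $|\pi|=0$ is a $\mathbb{Q}$-algebra isomorphism from $\mathcal{A}_{(\mathrm{des},\mathrm{comaj})}$ to the span of $\{\frac1{1-t}\}\cup\{\frac{q^kt^{j+1}}{(1-t)(1-qt)\cdots(1-q^nt)}x^n\}_{n\ge1,\,0\le j\le n-1,\,\binom{j+1}2\le k\le nj-\binom{j+1}2}$, a subalgebra of $\mathbb{Q}[[t*,q]][x]$. (d) For $n\ge1$, the $n$th homogeneous component of $\mathcal{A}_{(\mathrm{des},\mathrm{comaj})}$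 has dimension $\binom n3+n$.
   Context: A permutation of length $n$ is a sequence $\pi=\pi_1\cdots\pi_n$ of distinct positive integers. $\mathrm{des}(\pi)$ is the number of $i\in[n-1]$ with $\pi_i>\pi_{i+1}$, and $\mathrm{comaj}(\pi)=\sum_{i:\pi_i>\pi_{i+1}}(n-i)$ (both $0$ for the empty permutation). For disjoint permutations, $S(\pi,\sigma)$ is the set of shuffles (permutations of length $|\pi|+|\sigma|$ containing both as subsequences). A statistic $\mathrm{st}$ is shuffle-compatible if for disjoint $\pi,\sigma$ the multiset $\{\mathrm{st}(\tau):\tau\in S(\pi,\sigma)\}$ depends only on $\mathrm{st}(\pi),\mathrm{st}(\sigma),|\pi|,|\sigma|$; its shuffle algebra $\mathcal{A}_{\mathrm{st}}$ has basis the classes $[\pi]$ of permutations with equal length and $\mathrm{st}$-value, product $[\pi][\sigma]=\sum_{\tau\in S(\pi,\sigma)}[\tau]$, graded by length. $\binom{n}{k}_q$ is the $q$-binomial coefficient $[n]_q!/([k]_q![n-k]_q!)$ with $[n]_q!=\prod_{i=1}^n(1+q+\cdots+q^{i-1})$ (and it is $0$ when $0\le n<k$). $\mathbb{Q}[[t*,q]][x]$ denotes polynomials in $x$ with coefficients in formal power series in $t,q$, where multiplication is ordinary in $x$ and $q$ but is the Hadamard product in $t$: $(\sum_n a_nt^n)*(\sum_n b_nt^n)=\sum_n a_nb_nt^n$. *)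

(* Defs.v *)
From HB Require Import structures.
From mathcomp Require Import all_boot all_order all_algebra.
From mathcomp Require Import generic_quotient finmap.
From mathcomp.multinomials Require Import monalg.
From mathcomp Require Import boolp classical_sets functions.

Set Implicit Arguments.
Unset Strict Implicit.
Unset Printing Implicit Defensive.

Import GRing.Theory.
Local Open Scope ring_scope.

Section Span.
Context {K : nzRingType} {V : lmodType K}.

Definition lin_span (S : set V) : set V :=
  [set v | exists (n : nat) (c : 'I_n -> K) (b : 'I_n -> V),
     (forall i, S (b i)) /\ v = \sum_(i < n) c i *: b i].

Definition lin_indep (n : nat) (b : 'I_n -> V) : Prop :=
  forall c : 'I_n -> K, \sum_(i < n) c i *: b i = 0 -> forall i, c i = 0.

Definition has_dim (W : set V) (d : nat) : Prop :=
  exists b : 'I_d -> V, lin_indep b /\ W = lin_span (range b).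

End Span.

Section FunAlgebra.
Context (T : pointedType) (K : nzRingType).

Fact fun_scalerAl (A : lalgType K) (k : K) (f g : T -> A) :
  k *: (f * g) = (k *: f) * g.
Proof. by apply/funext => x; exact: scalerAl. Qed.

HB.instance Definition _ (A : lalgType K) :=
  GRing.Lmodule_isLalgebra.Build K (T -> A) (@fun_scalerAl A).

Fact fun_scalerAr (A : algType K) (k : K) (f g : T -> A) :
  k *: (f * g) = f * (k *: g).
Proof. by apply/funext => x; exact: scalerAr. Qed.

HB.instance Definition _ (A : algType K) :=
  GRing.Lalgebra_isAlgebra.Build K (T -> A) (@fun_scalerAr A).
HB.instance Definition _ (A : comAlgType K) := GRing.Algebra.on (T -> A).

End FunAlgebra.

(* {poly A} is canonically an algebra over A only; this is the same ring, as
   an algebra over the base ring of A. *)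
Definition polyalg (K : comNzRingType) (A : comAlgType K) : Type := {poly A}.

Section PolyAlg.
Context (K : comNzRingType) (A : comAlgType K).

HB.instance Definition _ := GRing.ComNzRing.copy (polyalg A) {poly A}.

Definition polyalg_scale (k : K) (p : polyalg A) : polyalg A :=
  (k%:A)%:P * (p : {poly A}).

Fact polyalg_scaleA a b p :
  polyalg_scale a (polyalg_scale b p) = polyalg_scale (a * b) p.
Proof.
by rewrite /polyalg_scale mulrA -polyCM -scalerAl mul1r scalerA.
Qed.

Fact polyalg_scale1 : left_id 1 polyalg_scale.
Proof. by move=> p; rewrite /polyalg_scale scale1r mul1r. Qed.

Fact polyalg_scaleDr : right_distributive polyalg_scale +%R.
Proof. by move=> a p q; rewrite /polyalg_scale -mulrDr. Qed.

Fact polyalg_scaleDl p : {morph polyalg_scale^~ p : a b / a + b}.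
Proof. by move=> a b; rewrite /polyalg_scale scalerDl polyCD -mulrDl. Qed.

HB.instance Definition _ := GRing.Zmodule_isLmodule.Build K (polyalg A)
  polyalg_scaleA polyalg_scale1 polyalg_scaleDr polyalg_scaleDl.

Fact polyalg_scaleAl (k : K) (p q : polyalg A) : k *: (p * q) = (k *: p) * q.
Proof. exact: mulrA. Qed.

HB.instance Definition _ :=
  GRing.Lmodule_isLalgebra.Build K (polyalg A) polyalg_scaleAl.
HB.instance Definition _ := GRing.Lalgebra_isComAlgebra.Build K (polyalg A).

End PolyAlg.

Record fps (R : Type) := Fps { fps_coef : nat -> R }.
Arguments Fps {R} _.

Notation "{ 'fps' R }" := (fps R) (at level 0, format "{ 'fps'  R }").

HB.instance Definition _ (R : Type) := [isNew for @fps_coef R].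
HB.instance Definition _ (R : choiceType) := [Choice of fps R by <:].

Lemma fpsP (R : Type) (f g : {fps R}) : fps_coef f =1 fps_coef g -> f = g.
Proof. by case: f g => [f] [g] /= /funext ->. Qed.

Section FpsZmod.
Context (R : zmodType).
Implicit Types f g h : {fps R}.

Definition fps_zero : {fps R} := Fps (fun=> 0).
Definition fps_opp f := Fps (fun n => - fps_coef f n).
Definition fps_add f g := Fps (fun n => fps_coef f n + fps_coef g n).

Fact fps_addA : associative fps_add.
Proof. by move=> f g h; apply/fpsP => n /=; rewrite addrA. Qed.
Fact fps_addC : commutative fps_add.
Proof. by move=> f g; apply/fpsP => n /=; rewrite addrC. Qed.
Fact fps_add0 : left_id fps_zero fps_add.
Proof. by move=> f; apply/fpsP => n /=; rewrite add0r. Qed.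
Fact fps_addN : left_inverse fps_zero fps_opp fps_add.
Proof. by move=> f; apply/fpsP => n /=; rewrite addNr. Qed.

HB.instance Definition _ :=
  GRing.isZmodule.Build {fps R} fps_addA fps_addC fps_add0 fps_addN.

End FpsZmod.

Section FpsRing.
Context (R : nzRingType).
Implicit Types f g h : {fps R}.

Definition fps_one : {fps R} := Fps (fun n => (n == 0%N)%:R).

Definition fps_mul f g : {fps R} :=
  Fps (fun n => \sum_(i < n.+1) fps_coef f i * fps_coef g (n - i)).

Definition fps_trunc n f : {poly R} := \poly_(i < n.+1) fps_coef f i.

Lemma coef_fps_trunc n f i : (i <= n)%N -> (fps_trunc n f)`_i = fps_coef f i.
Proof. by move=> le_in; rewrite coef_poly ltnS le_in. Qed.

Lemma coef_fps_mul m f g n : (n <= m)%N ->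
  fps_coef (fps_mul f g) n = (fps_trunc m f * fps_trunc m g)`_n.
Proof.
move=> le_nm; rewrite coefM /=; apply: eq_bigr => i _.
rewrite !coef_fps_trunc //; first exact: leq_trans (leq_subr _ _) le_nm.
by apply: leq_trans le_nm; rewrite -ltnS.
Qed.

Fact fps_mulA : associative fps_mul.
Proof.
move=> f g h; apply/fpsP => n.
transitivity ((fps_trunc n f * (fps_trunc n g * fps_trunc n h))`_n).
  rewrite coefM; apply: eq_bigr => i _.
  by rewrite coef_fps_trunc -1?ltnS // -(@coef_fps_mul n) ?leq_subr.
rewrite mulrA coefM; apply/esym; apply: eq_bigr => i _.
by rewrite -(@coef_fps_mul n) -1?ltnS // coef_fps_trunc ?leq_subr.
Qed.

Lemma fps_trunc1 n : fps_trunc n fps_one = 1.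
Proof.
apply/polyP => i; rewrite coef_poly coef1 /=.
by case: ltnP => //; case: i.
Qed.

Fact fps_mul1l : left_id fps_one fps_mul.
Proof.
move=> f; apply/fpsP => n.
by rewrite (@coef_fps_mul n) // fps_trunc1 mul1r coef_fps_trunc.
Qed.

Fact fps_mul1r : right_id fps_one fps_mul.
Proof.
move=> f; apply/fpsP => n.
by rewrite (@coef_fps_mul n) // fps_trunc1 mulr1 coef_fps_trunc.
Qed.

Fact fps_mulDl : left_distributive fps_mul +%R.
Proof.
move=> f g h; apply/fpsP => n /=; rewrite -big_split /=.
by apply: eq_bigr => i _; rewrite mulrDl.
Qed.

Fact fps_mulDr : right_distributive fps_mul +%R.
Proof.
move=> f g h; apply/fpsP => n /=; rewrite -big_split /=.
by apply: eq_bigr => i _; rewrite mulrDr.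
Qed.

Fact fps_one_neq0 : fps_one != 0 :> {fps R}.
Proof.
apply/eqP => /(congr1 (fun f => fps_coef f 0%N)) /= /eqP.
by rewrite oner_eq0.
Qed.

HB.instance Definition _ := GRing.Zmodule_isNzRing.Build {fps R}
  fps_mulA fps_mul1l fps_mul1r fps_mulDl fps_mulDr fps_one_neq0.

Definition fps_scale (c : R) f : {fps R} := Fps (fun n => c * fps_coef f n).

Fact fps_scaleA a b f : fps_scale a (fps_scale b f) = fps_scale (a * b) f.
Proof. by apply/fpsP => n /=; rewrite mulrA. Qed.
Fact fps_scale1 : left_id 1 fps_scale.
Proof. by move=> f; apply/fpsP => n /=; rewrite mul1r. Qed.
Fact fps_scaleDr : right_distributive fps_scale +%R.
Proof. by move=> a f g; apply/fpsP => n /=; rewrite mulrDr. Qed.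
Fact fps_scaleDl f : {morph fps_scale^~ f : a b / a + b}.
Proof. by move=> a b; apply/fpsP => n /=; rewrite mulrDl. Qed.

HB.instance Definition _ := GRing.Zmodule_isLmodule.Build R {fps R}
  fps_scaleA fps_scale1 fps_scaleDr fps_scaleDl.

Fact fps_scaleAl (c : R) f g : c *: (f * g) = (c *: f) * g.
Proof.
apply/fpsP => n /=; rewrite mulr_sumr.
by apply: eq_bigr => i _; rewrite mulrA.
Qed.

HB.instance Definition _ :=
  GRing.Lmodule_isLalgebra.Build R {fps R} fps_scaleAl.

Definition fpsC (c : R) : {fps R} := Fps (fun n => if n == 0%N then c else 0).
Definition fpsX : {fps R} := Fps (fun n => (n == 1%N)%:R).

End FpsRing.

Arguments fpsX {R}.

Section FpsComRing.
Context (R : comNzRingType).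

Fact fps_mulC : commutative (@fps_mul R).
Proof.
move=> f g; apply/fpsP => n.
by rewrite !(@coef_fps_mul _ n) // mulrC.
Qed.

HB.instance Definition _ :=
  GRing.PzRing_hasCommutativeMul.Build {fps R} fps_mulC.
HB.instance Definition _ := GRing.Lalgebra_isComAlgebra.Build R {fps R}.

End FpsComRing.

Section FpsUnitRing.
Context (R : comUnitRingType).
Implicit Types f g : {fps R}.

Definition fps_unit : {pred {fps R}} :=
  fun f => fps_coef f 0%N \is a GRing.unit.

(* The first n coefficients of the inverse of f, computed recursively. *)
Fixpoint fps_inv_seq f (n : nat) : seq R :=
  if n is m.+1 then
    let s := fps_inv_seq f m in
    rcons s (if m == 0%N then (fps_coef f 0%N)^-1
             else - (fps_coef f 0%N)^-1
                  * \sum_(i < m) s`_i * fps_coef f (m - i))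
  else [::].

Definition fps_inv f : {fps R} :=
  if f \in fps_unit then Fps (fun n => (fps_inv_seq f n.+1)`_n) else f.

Lemma size_fps_inv_seq f n : size (fps_inv_seq f n) = n.
Proof. by elim: n => //= n IHn; rewrite size_rcons IHn. Qed.

Lemma nth_fps_inv_seq f n i : (i < n)%N ->
  (fps_inv_seq f n)`_i = (fps_inv_seq f i.+1)`_i.
Proof.
elim: n => // n IHn; rewrite ltnS leq_eqVlt => /predU1P[-> // | lt_in].
by rewrite [in LHS]/= nth_rcons size_fps_inv_seq lt_in IHn.
Qed.

Fact fps_mulVx : {in fps_unit, left_inverse 1 fps_inv *%R}.
Proof.
move=> f Uf; have Uf0 : fps_coef f 0%N \is a GRing.unit := Uf.
rewrite /fps_inv Uf; set g := fun n => (fps_inv_seq f n.+1)`_n.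
have E m : g m = if m == 0%N then (fps_coef f 0%N)^-1
    else - (fps_coef f 0%N)^-1 * \sum_(i < m) g i * fps_coef f (m - i).
  rewrite /g /= nth_rcons size_fps_inv_seq ltnn eqxx; case: eqP => // _.
  by congr (_ * _); apply: eq_bigr => i _; rewrite nth_fps_inv_seq.
apply/fpsP => n; transitivity (\sum_(i < n.+1) g i * fps_coef f (n - i)) => //.
rewrite big_ord_recr /= subnn [g n]E.
have [-> | n0] := eqVneq n 0%N; first by rewrite big_ord0 add0r mulVr.
rewrite mulNr mulNr mulrAC mulVr // mul1r subrr.
by case: n n0.
Qed.

Fact fps_unitPl f g : g * f = 1 -> fps_unit f.
Proof.
move/(congr1 (fun h => fps_coef h 0%N)); rewrite /= big_ord1 /= => gf1.
by apply/unitrPr; exists (fps_coef g 0%N); rewrite mulrC.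
Qed.

Fact fps_inv_out : {in [predC fps_unit], fps_inv =1 id}.
Proof. by move=> f; rewrite inE /= /fps_inv => /negPf ->. Qed.

HB.instance Definition _ :=
  GRing.ComNzRing_hasMulInverse.Build {fps R} fps_mulVx fps_unitPl fps_inv_out.

End FpsUnitRing.

Definition qfact (n : nat) : {poly rat} :=
  \prod_(1 <= i < n.+1) \sum_(0 <= j < i) 'X^j.

(* The division is polynomial division, exact here. *)
Definition qbinom (n k : nat) : {poly rat} :=
  if (k <= n)%N then qfact n %/ (qfact k * qfact (n - k)) else 0.

Record permutation := Permutation {
  letters :> seq nat;
  permutationP : uniq letters && (0%N \notin letters)
}.

HB.instance Definition _ := [isSub for letters].
HB.instance Definition _ := [Choice of permutation by <:].

Definition perm_nil : permutation := @Permutation [::] isT.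

Definition disjoint_perm (pi sigma : permutation) : bool :=
  ~~ has [in letters sigma] pi.

Definition shuffles (pi sigma : permutation) : seq permutation :=
  pmap insub [seq tau <- permutations (letters pi ++ letters sigma)
             | subseq pi tau && subseq sigma tau].

Definition same_relative_order (pi sigma : permutation) : Prop :=
  size pi = size sigma /\
  forall i j : nat, (i < size pi)%N -> (j < size pi)%N ->
    (nth 0%N pi i < nth 0%N pi j)%N = (nth 0%N sigma i < nth 0%N sigma j)%N.

(* A permutation statistic depends only on the relative order of the letters;
   this is what provides disjoint representatives of any two classes. *)
Record statistic (V : eqType) := Statistic {
  stat :> permutation -> V;
  stat_order : forall pi sigma, same_relative_order pi sigma ->
    stat pi = stat sigma
}.

Definition shuffle_compatible (V : eqType) (st : statistic V) : Prop :=
  forall pi sigma pi' sigma' : permutation,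
    disjoint_perm pi sigma -> disjoint_perm pi' sigma' ->
    size pi = size pi' -> size sigma = size sigma' ->
    st pi = st pi' -> st sigma = st sigma' ->
    perm_eq [seq st tau | tau <- shuffles pi sigma]
            [seq st tau | tau <- shuffles pi' sigma'].

Lemma uniq_shuffles pi sigma : uniq (shuffles pi sigma).
Proof. by rewrite pmap_sub_uniq // filter_uniq // permutations_uniq. Qed.

Lemma mem_shuffles pi sigma tau : disjoint_perm pi sigma ->
  (tau \in shuffles pi sigma) =
  [&& size tau == (size pi + size sigma)%N, subseq pi tau & subseq sigma tau].
Proof.
move=> dj; rewrite mem_pmap_sub mem_filter mem_permutations /=.
case: (boolP (subseq pi tau)) => [s1|]; last by rewrite andbF.
case: (boolP (subseq sigma tau)) => [s2|]; last by rewrite !andbF.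
rewrite !andbT /=; apply/idP/eqP => [/perm_size-> | sz]; first by rewrite size_cat.
rewrite perm_sym; have [Upi _] := andP (permutationP pi).
have [Usg _] := andP (permutationP sigma).
have Ucat : uniq (letters pi ++ sigma).
  by rewrite cat_uniq Upi Usg andbT -all_predC; apply/allP => x xs /=;
     apply: contra dj => xp; apply/hasP; exists x.
have sub : {subset letters pi ++ sigma <= letters tau}.
  by move=> x; rewrite mem_cat => /orP[] /mem_subseq; apply.
have [] := uniq_min_size Ucat sub; first by rewrite size_cat sz.
move=> _ eqm; apply: uniq_perm => //.
by case/andP: (permutationP tau).
Qed.

Section Classes.
Context {V : eqType} (st : statistic V).

Definition st_equiv : rel permutation :=
  fun pi sigma : permutation => (size pi == size sigma) && (st pi == st sigma).

Fact st_equiv_refl : reflexive st_equiv.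
Proof. by move=> pi; rewrite /st_equiv !eqxx. Qed.
Fact st_equiv_sym : symmetric st_equiv.
Proof. by move=> pi sigma; rewrite /st_equiv eq_sym [st _ == _]eq_sym. Qed.
Fact st_equiv_trans : transitive st_equiv.
Proof.
by move=> tau pi sigma /andP[/eqP a /eqP b]; rewrite /st_equiv a b.
Qed.

Canonical st_equiv_equiv :=
  EquivRel st_equiv st_equiv_refl st_equiv_sym st_equiv_trans.

Definition st_class := {eq_quot st_equiv}%qT.
HB.instance Definition _ := Choice.on st_class.
HB.instance Definition _ := EqQuotient.on st_class.

Definition class_of (pi : permutation) : st_class := \pi_st_class%qT pi.

Lemma class_ofP (pi sigma : permutation) :
  reflect (size pi = size sigma /\ st pi = st sigma)
          (class_of pi == class_of sigma).
Proof.
rewrite /class_of eqmodE /= /st_equiv.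
by apply: (iffP andP) => [[/eqP a /eqP b] | [-> ->]].
Qed.

End Classes.

Section Shift.

Lemma shift_subproof (m : nat) (pi : permutation) :
  uniq [seq (m + i)%N | i <- pi] && (0%N \notin [seq (m + i)%N | i <- pi]).
Proof.
have /andP[U Z] := permutationP pi.
rewrite map_inj_uniq ?U /=; last exact: addnI.
apply/mapP => -[x xpi /esym/eqP]; rewrite addn_eq0 => /andP[_ /eqP x0].
by rewrite x0 (negPf Z) in xpi.
Qed.

Definition shift (m : nat) (pi : permutation) := Permutation (shift_subproof m pi).

Lemma shift_same_order m pi : same_relative_order (shift m pi) pi.
Proof.
split=> [|i j]; rewrite size_map // => lti ltj.
by rewrite !(nth_map 0%N) // ltn_add2l.
Qed.

Definition max_letter (s : seq nat) : nat := \max_(i <- s) i.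

Lemma shift_disjoint (s : seq nat) sigma x :
  x \in s -> x \notin letters (shift (max_letter s) sigma).
Proof.
move=> xs; apply/mapP => -[y ysg xE].
have : (x <= max_letter s)%N by rewrite /max_letter (big_rem x) //= leq_maxl.
rewrite xE -[leqRHS]addn0 leq_add2l leqn0 => /eqP y0.
by have /andP[_] := permutationP sigma; rewrite -y0 ysg.
Qed.

Lemma shift_disjoint_perm (pi sigma : permutation) :
  disjoint_perm pi (shift (max_letter pi) sigma).
Proof. by apply/hasPn => x /shift_disjoint; apply. Qed.

End Shift.

Section MalgLinear.
Context {K : choiceType} {V : lmodType rat}.

Definition malg_lin (F : K -> V) (f : {malg rat[K]}) : V :=
  \sum_(k <- msupp f) f@_k *: F k.

Lemma malg_linEw F f (E : {fset K}) : (msupp f `<=` E)%fset ->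
  malg_lin F f = \sum_(k <- E) f@_k *: F k.
Proof.
move=> sub; rewrite /malg_lin.
apply: (big_fset_incl _ sub) => k _ kf.
by rewrite mcoeff_outdom // scale0r.
Qed.

Fact malg_lin_linear F : linear (malg_lin F).
Proof.
move=> a f g; pose E := (msupp (a *: f + g) `|` (msupp f `|` msupp g))%fset.
rewrite !(@malg_linEw F _ E) ?fsubsetUl //; last 2 first.
- by rewrite /E fsubsetU // fsubsetUr orbT.
- by rewrite /E fsubsetU // fsubsetUl orbT.
rewrite scaler_sumr -big_split; apply: eq_bigr => k _ /=.
by rewrite mcoeffD mcoeffZ scalerDl scalerA.
Qed.

HB.instance Definition _ F :=
  GRing.isLinear.Build rat {malg rat[K]} V *:%R (malg_lin F) (malg_lin_linear F).

Lemma malg_linU F k : malg_lin F << k >> = F k.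
Proof.
by rewrite /malg_lin msuppU oner_eq0 big_seq_fset1 mcoeffUU scale1r.
Qed.

Lemma malg_basisE (f : {malg rat[K]}) : f = \sum_(k <- msupp f) f@_k *: << k >>.
Proof.
rewrite {1}[f]monalgE; apply: eq_bigr => k _; apply/malgP => l.
by rewrite mcoeffZ !mcoeffU; case: eqP; rewrite ?mulr1 ?mulr0.
Qed.

End MalgLinear.

Lemma eq_malg_lin (K : choiceType) (V : lmodType rat) (F G : {linear {malg rat[K]} -> V}) :
  (forall k, F << k >> = G << k >>) -> F =1 G.
Proof.
move=> eqFG f; rewrite [f]malg_basisE !linear_sum; apply: eq_bigr => k _.
by rewrite !linearZ eqFG.
Qed.

Section ShuffleAlgebra.
Context {V : eqType} {st : statistic V}.
Local Notation cls := (@class_of V st).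

Lemma stat_shift m pi : st (shift m pi) = st pi.
Proof. exact/stat_order/shift_same_order. Qed.

Lemma class_of_repr (k : st_class st) : cls (repr k) = k.
Proof. by rewrite /class_of reprK. Qed.

Lemma class_of_shift m pi : cls (shift m pi) = cls pi.
Proof. by apply/eqP/class_ofP; rewrite stat_shift size_map. Qed.

Definition shuffle_sum (pi sigma : permutation) : {malg rat[st_class st]} :=
  \sum_(tau <- shuffles pi sigma) << cls tau >>.

Definition shuffle_mul_class (k l : st_class st) : {malg rat[st_class st]} :=
  shuffle_sum (repr k) (shift (max_letter (repr k)) (repr l)).

(* Locked only to keep unification from unfolding it. *)
Definition shuffle_mul (f g : {malg rat[st_class st]}) : {malg rat[st_class st]} :=
  locked (malg_lin (fun k => malg_lin (fun l => shuffle_mul_class k l) g) f).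

Lemma shuffle_mul_def f g : shuffle_mul f g =
  malg_lin (fun k => malg_lin (fun l => shuffle_mul_class k l) g) f.
Proof. by rewrite /shuffle_mul -lock. Qed.

(* Shuffle-compatibility makes the product independent of the disjoint
   representatives chosen in shuffle_mul_class: see shuffle_basisM. *)
Definition shuffle_algebra (Hst : shuffle_compatible st) : Type :=
  {malg rat[st_class st]}.

Section Laws.
Variable Hst : shuffle_compatible st.

Definition shuffle_mulr g f := shuffle_mul f g.

Fact shuffle_mul_linearl g : linear (shuffle_mulr g).
Proof. by move=> a f f'; rewrite /shuffle_mulr !shuffle_mul_def linearP. Qed.

Fact shuffle_mul_linearr f : linear (shuffle_mul f).
Proof.
move=> a g g'; rewrite !shuffle_mul_def /malg_lin scaler_sumr -big_split /=.
apply: eq_bigr => k _.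
by rewrite -![\sum_(_ <- msupp _) _ *: _]/(malg_lin _ _) linearP scalerDr
   !scalerA mulrC.
Qed.

HB.instance Definition _ g := GRing.isLinear.Build rat {malg rat[st_class st]}
  {malg rat[st_class st]} *:%R (shuffle_mulr g) (shuffle_mul_linearl g).
HB.instance Definition _ f := GRing.isLinear.Build rat {malg rat[st_class st]}
  {malg rat[st_class st]} *:%R (shuffle_mul f) (shuffle_mul_linearr f).

Lemma shuffle_sum_class pi sigma pi' sigma' :
  disjoint_perm pi sigma -> disjoint_perm pi' sigma' ->
  cls pi = cls pi' -> cls sigma = cls sigma' ->
  shuffle_sum pi sigma = shuffle_sum pi' sigma'.
Proof.
move=> dj dj' /eqP/class_ofP[sz1 st1] /eqP/class_ofP[sz2 st2].
have pq := Hst dj dj' sz1 sz2 st1 st2.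
suff pc : perm_eq [seq cls tau | tau <- shuffles pi sigma]
                  [seq cls tau | tau <- shuffles pi' sigma'].
  rewrite /shuffle_sum -(big_map cls xpredT (fun k => << k >>)).
  by rewrite (perm_big _ pc) big_map.
have cnt a b : disjoint_perm a b -> forall rho,
    count_mem (cls rho) [seq cls tau | tau <- shuffles a b] =
    if size rho == (size a + size b)%N
    then count_mem (st rho) [seq st tau | tau <- shuffles a b] else 0%N.
  move=> djab rho; rewrite !count_map.
  have [szE|szN] := eqVneq; last first.
    apply/eqP; rewrite -leqn0 leqNgt -has_count; apply/hasPn => tau.
    rewrite mem_shuffles // => /and3P[/eqP sz _ _] /=.
    by apply/negP => /class_ofP[E _]; rewrite -sz E eqxx in szN.
  apply: eq_in_count => tau; rewrite mem_shuffles // => /and3P[/eqP sz _ _] /=.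
  by apply/class_ofP/eqP => [[]|->] //; rewrite sz.
apply/permP => /= P; apply/permP: P; apply/allP => /= k _.
by rewrite -(class_of_repr k) !cnt // sz1 sz2 (permP pq).
Qed.

Lemma shuffle_mulE pi sigma : disjoint_perm pi sigma ->
  shuffle_mul << cls pi >> << cls sigma >> = shuffle_sum pi sigma.
Proof.
move=> dj; rewrite shuffle_mul_def !malg_linU /shuffle_mul_class.
apply: shuffle_sum_class => //; rewrite ?class_of_shift ?class_of_repr //.
exact: shift_disjoint_perm.
Qed.

Lemma disjoint_reprs2 (k l : st_class st) : exists pi sigma,
  [/\ disjoint_perm pi sigma, cls pi = k & cls sigma = l].
Proof.
exists (repr k), (shift (max_letter (repr k)) (repr l)).
by rewrite class_of_shift !class_of_repr shift_disjoint_perm.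
Qed.

Lemma disjoint_reprs3 (k l m : st_class st) : exists pi sigma rho,
  [/\ disjoint_perm pi sigma, disjoint_perm pi rho, disjoint_perm sigma rho &
   [/\ cls pi = k, cls sigma = l & cls rho = m]].
Proof.
have [pi [sigma [dj pik sl]]] := disjoint_reprs2 k l.
pose M := max_letter (letters pi ++ letters sigma).
exists pi, sigma, (shift M (repr m)).
have D x : x \in letters pi ++ letters sigma -> x \notin letters (shift M (repr m)).
  exact: shift_disjoint.
split; rewrite ?class_of_shift ?class_of_repr //; apply/hasPn => x xp;
  by apply: D; rewrite mem_cat xp ?orbT.
Qed.

Lemma disjoint_permC pi sigma : disjoint_perm pi sigma = disjoint_perm sigma pi.
Proof. by rewrite /disjoint_perm has_sym. Qed.

Lemma shuffle_sumC pi sigma : disjoint_perm pi sigma ->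
  shuffle_sum pi sigma = shuffle_sum sigma pi.
Proof.
move=> dj; apply: perm_big; apply: uniq_perm; rewrite ?uniq_shuffles // => tau.
rewrite !mem_shuffles // 1?disjoint_permC // addnC.
by rewrite [subseq pi tau && _]andbC.
Qed.

Fact shuffle_mulC : commutative shuffle_mul.
Proof.
move=> f g.
have H k h : shuffle_mul << k >> h = shuffle_mulr << k >> h.
  move: h; apply: eq_malg_lin => l.
  have [pi [sigma [dj <- <-]]] := disjoint_reprs2 k l.
  have dj' : disjoint_perm sigma pi by rewrite disjoint_permC.
  change (shuffle_mul << cls pi >> << cls sigma >>
        = shuffle_mul << cls sigma >> << cls pi >>).
  rewrite (shuffle_mulE dj).
  rewrite (shuffle_mulE dj').
  exact: shuffle_sumC.
have H' : shuffle_mulr g =1 shuffle_mul g.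
  by apply: eq_malg_lin => k; exact: H.
exact: H'.
Qed.

Lemma shuffle_mul_suml (I : Type) (r : seq I) (F : I -> {malg rat[st_class st]}) g :
  shuffle_mul (\sum_(i <- r) F i) g = \sum_(i <- r) shuffle_mul (F i) g.
Proof. exact: (linear_sum (shuffle_mulr g)). Qed.

Lemma shuffle_mul_sumr (I : Type) (r : seq I) (F : I -> {malg rat[st_class st]}) f :
  shuffle_mul f (\sum_(i <- r) F i) = \sum_(i <- r) shuffle_mul f (F i).
Proof. exact: (linear_sum (shuffle_mul f)). Qed.

Lemma shuffle_mulZl a f g : shuffle_mul (a *: f) g = a *: shuffle_mul f g.
Proof. exact: (linearZZ (shuffle_mulr g)). Qed.

Lemma shuffle_mulZr a f g : shuffle_mul f (a *: g) = a *: shuffle_mul f g.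
Proof. exact: (linearZZ (shuffle_mul f)). Qed.

Fact shuffle_mulDl : left_distributive shuffle_mul +%R.
Proof. by move=> f f' g; exact: (linearD (shuffle_mulr g)). Qed.

Fact shuffle_mulDr : right_distributive shuffle_mul +%R.
Proof. by move=> g f f'; exact: (linearD (shuffle_mul g)). Qed.

Definition shuffles3 (pi sigma rho : permutation) : seq permutation :=
  [seq u <- pmap insub (permutations (letters pi ++ sigma ++ rho)) |
   [&& subseq pi (letters u), subseq sigma (letters u) & subseq rho (letters u)]].

Lemma disjoint_shuffles pi sigma rho tau : disjoint_perm pi sigma ->
  disjoint_perm pi rho -> disjoint_perm sigma rho ->
  tau \in shuffles pi sigma -> disjoint_perm tau rho.
Proof.
move=> d12 d13 d23; rewrite mem_pmap_sub mem_filter mem_permutations => /andP[_ p].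
rewrite /disjoint_perm (perm_has _ p) has_cat negb_or.
by apply/andP; split; [exact: d13 | exact: d23].
Qed.

Lemma mem_shuffles_perm pi sigma tau : (tau \in shuffles pi sigma) =
  [&& perm_eq tau (letters pi ++ sigma), subseq pi tau & subseq sigma tau].
Proof. by rewrite mem_pmap_sub mem_filter mem_permutations andbC. Qed.

Lemma mem_shuffles3 pi sigma rho u : (u \in shuffles3 pi sigma rho) =
  [&& perm_eq u (letters pi ++ sigma ++ rho), subseq pi u, subseq sigma u
    & subseq rho u].
Proof. by rewrite mem_filter mem_pmap_sub mem_permutations andbC. Qed.

Lemma restrict_subproof (P : pred nat) (u : permutation) :
  uniq (filter P u) && (0%N \notin filter P u).
Proof.
have /andP[U Z] := permutationP u.
by rewrite filter_uniq // mem_filter negb_and Z orbT.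
Qed.

Lemma shuffle_filter pi sigma rho tau u : disjoint_perm tau rho ->
  tau \in shuffles pi sigma -> u \in shuffles tau rho ->
  letters tau = filter [in letters pi ++ sigma] u.
Proof.
move=> d; rewrite !mem_shuffles_perm => /and3P[/perm_mem p _ _] /and3P[_ s _].
have /andP[U _] := permutationP u.
have := subseq_uniqP U s => {1}->.
by apply: eq_filter => x; rewrite /= p.
Qed.

Lemma shuffle_sum3 pi sigma rho : disjoint_perm pi sigma ->
  disjoint_perm pi rho -> disjoint_perm sigma rho ->
  \sum_(tau <- shuffles pi sigma) shuffle_sum tau rho =
  \sum_(u <- shuffles3 pi sigma rho) << cls u >>.
Proof.
move=> d12 d13 d23; pose S tau := shuffles tau rho.
transitivity (\sum_(u <- [seq u | tau <- shuffles pi sigma, u <- S tau])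
               (<< cls u >> : {malg rat[st_class st]})).
  by rewrite big_allpairs_dep.
apply: perm_big; apply: uniq_perm.
- apply: allpairs_uniq_dep; first exact: uniq_shuffles.
    by move=> tau _; exact: uniq_shuffles.
  move=> _ _ /allpairsPdep[t [u [tS uS ->]]] /allpairsPdep[t' [u' [tS' uS' ->]]] /= uu.
  have dt := disjoint_shuffles d12 d13 d23 tS.
  have dt' := disjoint_shuffles d12 d13 d23 tS'.
  suff tt : t = t' by rewrite tt uu.
  apply: val_inj; rewrite /= (shuffle_filter dt tS uS).
  by rewrite (shuffle_filter dt' tS' uS') uu.
- by rewrite filter_uniq // pmap_sub_uniq // permutations_uniq.
move=> u; rewrite mem_shuffles3; apply/allpairsPdep/and4P.
  move=> [t [v [tS vS ->]]]; move: tS vS; rewrite /S !mem_shuffles_perm.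
  move=> /and3P[p1 s1 s2] /and3P[p2 s3 s4]; split=> //.
  - by rewrite (perm_trans p2) // catA perm_cat2r.
  - exact: subseq_trans s1 s3.
  - exact: subseq_trans s2 s3.
move=> [p s1 s2 s3].
pose t := Permutation (restrict_subproof [in letters pi ++ sigma] u).
have pt : perm_eq t (letters pi ++ sigma).
  rewrite /= (perm_trans (perm_filter _ p)) // catA filter_cat.
  rewrite (all_filterP _); last exact/allP.
  rewrite [X in _ ++ X](_ : _ = [::]) ?cats0 //; apply/eqP; rewrite -[_ == _]negbK -has_filter.
  apply/hasPn => x xr; rewrite mem_cat negb_or; apply/andP; split.
    by apply/negP => xp; move/hasPn/(_ x xp): d13; rewrite /= xr.
  by apply/negP => xp; move/hasPn/(_ x xp): d23; rewrite /= xr.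
exists t, u; split=> //; rewrite ?/S mem_shuffles_perm.
  by rewrite pt /= !subseq_filter s1 s2 !andbT;
     apply/andP; split; apply/allP => x xp; rewrite mem_cat xp ?orbT.
rewrite s3 filter_subseq !andbT (perm_trans p) // catA perm_cat2r.
by rewrite perm_sym.
Qed.

Fact shuffle_mulA : associative shuffle_mul.
Proof.
have B k l m : shuffle_mul << k >> (shuffle_mul << l >> << m >>)
             = shuffle_mul (shuffle_mul << k >> << l >>) << m >>.
  have [pi [sigma [rho [d12 d13 d23 [<- <- <-]]]]] := disjoint_reprs3 k l m.
  rewrite (shuffle_mulE d23) (shuffle_mulE d12) /shuffle_sum shuffle_mul_sumr shuffle_mul_suml.
  transitivity (\sum_(tau <- shuffles sigma rho) shuffle_sum tau pi).
    rewrite big_seq [RHS]big_seq; apply: eq_bigr => tau tauS.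
    have dt : disjoint_perm tau pi.
      by apply: disjoint_shuffles tauS; rewrite // disjoint_permC.
    by rewrite shuffle_mulC shuffle_mulE.
  transitivity (\sum_(tau <- shuffles pi sigma) shuffle_sum tau rho); last first.
    rewrite big_seq [RHS]big_seq; apply: eq_bigr => tau tauS.
    by rewrite shuffle_mulE //; exact: disjoint_shuffles tauS.
  rewrite !shuffle_sum3 // 1?disjoint_permC // 1?disjoint_permC //.
  rewrite /shuffles3; apply: perm_big; apply: uniq_perm.
  - by rewrite filter_uniq // pmap_sub_uniq // permutations_uniq.
  - by rewrite filter_uniq // pmap_sub_uniq // permutations_uniq.
  move=> u; rewrite !mem_shuffles3; congr (_ && _).
    by apply: permPr; rewrite catA perm_catC.
  by do 3! case: (subseq _ _).
have B2 k l h := @eq_malg_lin _ _ (shuffle_mul << k >> \o shuffle_mul << l >>)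
  (shuffle_mul (shuffle_mul << k >> << l >>)) (B k l) h.
have B1 k g h := @eq_malg_lin _ _ (shuffle_mul << k >> \o shuffle_mulr h)
  (shuffle_mulr h \o shuffle_mul << k >>) (fun l => B2 k l h) g.
move=> f g h.
exact: (@eq_malg_lin _ _ (shuffle_mulr (shuffle_mul g h))
  (shuffle_mulr h \o shuffle_mulr g) (fun k => B1 k g h) f).
Qed.

Definition shuffle_one : {malg rat[st_class st]} := << cls perm_nil >>.

Fact shuffle_mul1l : left_id shuffle_one shuffle_mul.
Proof.
suff B k : shuffle_mul shuffle_one << k >> = << k >>.
  by move=> f; exact: (@eq_malg_lin _ _ (shuffle_mul shuffle_one) idfun B f).
have d : disjoint_perm perm_nil (repr k) by [].
rewrite -{1}(class_of_repr k) (shuffle_mulE d).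
suff p : perm_eq (shuffles perm_nil (repr k)) [:: repr k].
  by rewrite /shuffle_sum (perm_big _ p) big_seq1 class_of_repr.
apply: uniq_perm; rewrite ?uniq_shuffles // => tau.
rewrite mem_shuffles // inE sub0seq /= add0n.
apply/andP/eqP => [[/eqP sz s] | ->]; last by rewrite subseq_refl.
by apply/val_inj/esym/eqP; rewrite /= -(size_subseq_leqif s) sz.
Qed.

Fact shuffle_mul1r : right_id shuffle_one shuffle_mul.
Proof. by move=> f; rewrite shuffle_mulC shuffle_mul1l. Qed.

Fact shuffle_one_neq0 : shuffle_one != 0.
Proof. by rewrite monalgU_eq0 oner_eq0. Qed.

HB.instance Definition _ :=
  GRing.Lmodule.copy (shuffle_algebra Hst) {malg rat[st_class st]}.
HB.instance Definition _ := GRing.Zmodule_isNzRing.Build (shuffle_algebra Hst)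
  shuffle_mulA shuffle_mul1l shuffle_mul1r shuffle_mulDl shuffle_mulDr
  shuffle_one_neq0.
HB.instance Definition _ :=
  GRing.PzRing_hasCommutativeMul.Build (shuffle_algebra Hst) shuffle_mulC.

Fact shuffle_scaleAl (a : rat) (f g : shuffle_algebra Hst) :
  a *: (f * g) = (a *: f) * g.
Proof. exact/esym/shuffle_mulZl. Qed.

HB.instance Definition _ :=
  GRing.Lmodule_isLalgebra.Build rat (shuffle_algebra Hst) shuffle_scaleAl.
HB.instance Definition _ :=
  GRing.Lalgebra_isComAlgebra.Build rat (shuffle_algebra Hst).

Definition shuffle_basis (pi : permutation) : shuffle_algebra Hst :=
  << class_of st pi >>.

Lemma shuffle_basisM pi sigma : disjoint_perm pi sigma ->
  shuffle_basis pi * shuffle_basis sigma =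
  \sum_(tau <- shuffles pi sigma) shuffle_basis tau.
Proof. exact: shuffle_mulE. Qed.

Lemma shuffle_basis1 : shuffle_basis perm_nil = 1.
Proof. by []. Qed.

Lemma shuffle_basis_eq pi sigma : shuffle_basis pi = shuffle_basis sigma <->
  size pi = size sigma /\ st pi = st sigma.
Proof.
split=> [/malgP/(_ (class_of st sigma)) | E].
  rewrite !mcoeffU eqxx; case: eqP => [/eqP/class_ofP // | _] /eqP.
  by rewrite eq_sym oner_eq0.
by rewrite /shuffle_basis (eqP (introT (class_ofP st pi sigma) E)).
Qed.

Definition homogeneous (n : nat) : set (shuffle_algebra Hst) :=
  lin_span [set shuffle_basis pi | pi in [set pi : permutation | size pi = n]].

End Laws.
End ShuffleAlgebra.

Arguments homogeneous {V st} Hst n.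

(* Positions are counted from 1: i is a descent iff s_i > s_(i+1). *)
Definition descents (s : seq nat) : seq nat :=
  [seq i <- iota 1 (size s).-1 | (nth 0 s i < nth 0 s i.-1)%N].

Definition des (s : seq nat) : nat := size (descents s).

Definition comaj (s : seq nat) : nat := \sum_(i <- descents s) (size s - i).

Fact des_comaj_order (pi sigma : permutation) : same_relative_order pi sigma ->
  (des pi, comaj pi) = (des sigma, comaj sigma).
Proof.
move=> [sz ord]; suff E : descents pi = descents sigma by rewrite /des /comaj E sz.
rewrite /descents -sz; apply: eq_in_filter => i; rewrite mem_iota add1n => /andP[i1 lei].
by apply: ord; case: (size pi) i i1 lei => [|n] [|i] //= _; rewrite ltnS // => /ltnW.
Qed.

Definition des_comaj : statistic (nat * nat)%type :=
  Statistic des_comaj_order.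

Definition q_x_algebra : Type := polyalg ({poly rat} : comAlgType rat).
HB.instance Definition _ := GRing.ComAlgebra.on q_x_algebra.

(* Q[[t, q]], as power series in t over Q[[q]]. *)
Definition tq_fps : Type := {fps {fps rat}}.
HB.instance Definition _ := GRing.ComUnitRing.on tq_fps.

Definition tvar : tq_fps := fpsX.
Definition qvar : tq_fps := fpsC (fpsX : {fps rat}).

(* Q[[t*, q]]: families of coefficients of the powers of t, multiplied
   pointwise, which is the Hadamard product in t. *)
Definition hadamard_tq : Type := nat -> {fps rat}.
HB.instance Definition _ := GRing.ComAlgebra.copy hadamard_tq (nat -> {fps rat}).

Definition to_hadamard (f : tq_fps) : hadamard_tq := fps_coef f.

Definition tq_x_algebra : Type := polyalg (hadamard_tq : comAlgType rat).
HB.instance Definition _ := GRing.ComAlgebra.on tq_x_algebra.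

(* q^k binom(p - j + n - 1, n)_q x^n, as a function of p. The truncated
   subtraction only matters when p = n = j = 0, where binom(-1, 0)_q = 1. *)
Definition qbinom_fun (k j n : nat) : nat -> q_x_algebra :=
  fun p => ('X^k * qbinom (p + n - j.+1) n)%:P * 'X^n.

Definition qbinom_span : set (nat -> q_x_algebra) :=
  lin_span ([set 1] `|`
    [set f | exists n j k : nat,
       [/\ (1 <= n)%N, (j <= n - 1)%N,
           ('C(j + 1, 2) <= k <= n * j - 'C(j + 1, 2))%N
         & f = qbinom_fun k j n]]).

(* These fractions are taken in the ordinary ring Q[[t, q]], before passing to
   the Hadamard product. *)
Definition tq_const : tq_x_algebra := (to_hadamard (1 / (1 - tvar)))%:P.

Definition tq_fraction (k j n : nat) : tq_x_algebra :=
  (to_hadamard (qvar ^+ k * tvar ^+ (j + 1)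
                / \prod_(0 <= i < n.+1) (1 - qvar ^+ i * tvar)))%:P * 'X^n.

Definition tq_span : set tq_x_algebra :=
  lin_span ([set tq_const] `|`
    [set f | exists n j k : nat,
       [/\ (1 <= n)%N, (j <= n - 1)%N,
           ('C(j + 1, 2) <= k <= n * j - 'C(j + 1, 2))%N
         & f = tq_fraction k j n]]).

(* Main.v *)
(* Stanley's P-partitions: q^(comaj pi) [p - des pi + n - 1 choose n]_q is the
   generating function, by sum, of the words f over [0, p) for which the
   biletters (f_i, pi_i) increase lexicographically. Merging two sorted sequences
   of biletters over disjoint letters gives a sorted sequence over a shuffle, so
   these generating functions multiply like the shuffle algebra. Since the one
   with j descents vanishes for p <= j and is a power of q at p = j + 1 (n > 0),
   they are linearly independent for distinct (des, comaj), which yields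
   shuffle-compatibility and injectivity. Their generating series in t is
   q^comaj t^(des + 1) / ((1 - t) ... (1 - q^n t)). *)
Require Import Defs.
From HB Require Import structures.
From mathcomp Require Import all_boot all_order all_algebra.
From mathcomp Require Import generic_quotient finmap zify ring.
From mathcomp.multinomials Require Import monalg.
From mathcomp Require Import boolp classical_sets functions.

Set Implicit Arguments.
Unset Strict Implicit.
Unset Printing Implicit Defensive.

Import GRing.Theory.
Local Open Scope classical_set_scope.
Local Open Scope ring_scope.

(** * The q-Pascal rule *)

Lemma qfactS n : qfact n.+1 = qfact n * \sum_(0 <= j < n.+1) 'X^j.
Proof. by rewrite /qfact big_nat_recr. Qed.

Lemma qfact_neq0 n : qfact n != 0.
Proof.
elim: n => [|n IHn]; first by rewrite /qfact big_nil oner_eq0.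
(* At q = 0 the new factor 1 + q + ... + q^n takes the value 1. *)
rewrite qfactS mulf_neq0 //; apply/eqP => /(congr1 (horner^~ 0)) /eqP.
rewrite horner0 horner_sum big_nat_recl // big1 => [|i _].
  by rewrite hornerXn expr0 addr0 oner_eq0.
by rewrite hornerXn expr0n.
Qed.

(** The q-binomials by recursion, free of polynomial division; in the last branch [k] is [k'.+1]. *)
Fixpoint qpascal (n k : nat) : {poly rat} :=
  match n, k with
  | _, 0 => 1
  | 0, _.+1 => 0
  | n'.+1, k'.+1 => qpascal n' k' + 'X^k * qpascal n' k
  end.

Lemma qpascal_gt n k : (n < k)%N -> qpascal n k = 0.
Proof.
elim: n k => [|n IHn] [|k] //= lt_nk.
by rewrite !IHn ?mulr0 ?addr0 //; lia.
Qed.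

Lemma qpascal_fact n k : (k <= n)%N ->
  qpascal n k * (qfact k * qfact (n - k)) = qfact n.
Proof.
have q0 : qfact 0 = 1 by rewrite /qfact big_nil.
elim: n k => [|n IHn] [|k] //=; rewrite ?ltnS ?q0 ?mul1r ?subn0 // => lekn.
rewrite subSS.
(* [n+1]_q = [k+1]_q + q^(k+1) [n-k]_q; each summand matches one term of the Pascal rule. *)
have -> : qfact n.+1 = qfact n * (\sum_(0 <= j < k.+1) 'X^j)
            + qfact n * ('X^(k.+1) * \sum_(0 <= j < n - k) 'X^j).
  rewrite -mulrDr qfactS (@big_cat_nat _ _ _ k.+1) //=; congr (_ * (_ + _)).
  rewrite -{1}[k.+1]add0n big_addn subSS mulr_sumr.
  by apply: eq_bigr => i _; rewrite -exprD addnC.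
rewrite mulrDl; congr (_ + _); first by rewrite -(IHn k) // qfactS; ring.
case: (ltnP k n) => [lt_kn | le_nk]; last first.
  by rewrite qpascal_gt ?ltnS // (eqP le_nk) big_nil !mulr0 mul0r.
have -> : (n - k = (n - k.+1).+1)%N by lia.
rewrite [qfact (_ - _).+1]qfactS -(IHn k.+1) //; ring.
Qed.

Lemma qbinomE n k : qbinom n k = qpascal n k.
Proof.
rewrite /qbinom; case: leqP => [le_kn | /qpascal_gt-> //].
by rewrite -(qpascal_fact le_kn) mulpK // mulf_neq0 ?qfact_neq0.
Qed.

Lemma qbinom0 n : qbinom n 0 = 1.
Proof. by rewrite qbinomE; case: n. Qed.

Lemma qbinom_gt n k : (n < k)%N -> qbinom n k = 0.
Proof. by rewrite qbinomE; exact: qpascal_gt. Qed.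

Lemma qbinomS n k : qbinom n.+1 k.+1 = qbinom n k + 'X^(k.+1) * qbinom n k.+1.
Proof. by rewrite !qbinomE. Qed.

Lemma qbinomnn n : qbinom n n = 1.
Proof.
by elim: n => [|n IHn]; rewrite ?qbinom0 // qbinomS IHn qbinom_gt ?mulr0 ?addr0.
Qed.

(** The hockey-stick identity: the q-Pascal rule iterated in the upper index. With d <= n every
    subtraction is exact. *)
Lemma qbinom_hockey n d M : (d <= n)%N ->
  \sum_(i < M) 'X^(i * n.+1) * qbinom (M - i + n - d.+1) n
  = qbinom (M + n.+1 - d.+1) n.+1.
Proof.
move=> le_dn; elim: M => [|M IHM]; first by rewrite big_ord0 qbinom_gt //; lia.
rewrite big_ord_recl expr0 mul1r subn0.
have -> : (M.+1 + n.+1 - d.+1 = (M + n.+1 - d.+1).+1)%N by lia.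
rewrite qbinomS -IHM mulr_sumr; congr (qbinom _ _ + _); first by lia.
apply: eq_bigr => i _; by rewrite mulrA -exprD lift0 mulSn subSS.
Qed.

(** * P-partitions and shuffles *)

Lemma descents_cons2 c x s : descents (c :: x :: s) =
  nseq (x < c)%N 1%N ++ map succn (descents (x :: s)).
Proof.
rewrite /descents /= -[RHS]/(_ ++ _).
have -> : iota 2 (size s) = map succn (iota 1 (size s)) by rewrite -(iotaDl 1 1).
rewrite filter_map /=.
have -> : [seq i <- iota 1 (size s)
    | preim succn (fun i => nth 0 (c :: x :: s) i < nth 0 (c :: x :: s) i.-1)%N i]
  = [seq i <- iota 1 (size s) | (nth 0 (x :: s) i < nth 0 (x :: s) i.-1)%N].
  by apply: eq_in_filter => -[|i] //; rewrite mem_iota.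
by case: (x < c)%N.
Qed.

Lemma des_cons2 c x s : des (c :: x :: s) = ((x < c) + des (x :: s))%N.
Proof. by rewrite /des descents_cons2 size_cat size_nseq size_map. Qed.

(** Prepending a letter raises the length and all descent positions by one, so old descents keep
    their weights. *)
Lemma comaj_cons2 c x s :
  comaj (c :: x :: s) = ((x < c) * (size s).+1 + comaj (x :: s))%N.
Proof.
rewrite /comaj descents_cons2 big_cat big_map /=; congr (_ + _)%N.
by case: (x < c)%N; rewrite ?big_nil ?big_cons ?big_nil ?addn0 ?mul1n ?subSS ?subn0.
Qed.

Lemma des_lt s : s != [::] -> (des s < size s)%N.
Proof.
case: s => // x s _; elim: s x => // y s IHs x.
rewrite des_cons2; apply: leq_ltn_trans (leq_add (leq_b1 _) (leqnn _)) _.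
exact: IHs.
Qed.

Section Biwords.
Variable p : nat.

(** Equal values are allowed only where the letters do not decrease, so a P-partition rises strictly
    at each descent. *)
Definition lex_le (a b : nat * nat) : bool :=
  (a.1 < b.1)%N || (a.1 == b.1) && (a.2 <= b.2)%N.

(* Generating function of the words f over [0, p), by their sum, such that the
    pairs (f_i, s_i) are weakly increasing, starting from a, in the
    lexicographic order: these f are the P-partitions of s. *)
Fixpoint biword_gf (a : nat * nat) (s : seq nat) : {poly rat} :=
  if s is x :: s' then
    \sum_(u < p | lex_le a (u : nat, x)) 'X^u * biword_gf (u : nat, x) s'
  else 1.

(** The start (v, c) acts as a letter c of value v in front of s, hence [c :: s]. Summing over the
    value of the first letter of s turns the induction hypothesis into the hockey-stick sum. *)
Lemma biword_gfE v c s : (v < p)%N -> biword_gf (v, c) s =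
  'X^(v * size s + comaj (c :: s))
  * qbinom (p - v + size s - (des (c :: s)).+1) (size s).
Proof.
elim: s v c => [|x s IHs] v c lt_vp /=.
  by rewrite qbinom0 muln0 /comaj big_nil mulr1.
(* [w] is the least value allowed for x: a descent from c to x excludes the tie u = v. *)
pose w := (v + (x < c))%N; have le_wp : (w <= p)%N by rewrite /w; case: (x < c)%N; lia.
have lexE u : lex_le (v, c) (u, x) = (w <= u)%N.
  by rewrite /lex_le /w /=; case: (ltnP x c) => /=; lia.
transitivity (\sum_(i < p - w) 'X^(w + i) * biword_gf ((w + i)%N, x) s).
  rewrite -(big_mkord (fun u => lex_le (v, c) (u, x))
                      (fun u => 'X^u * biword_gf (u, x) s)).
  rewrite (big_cat_nat (n := w)) //= big_nat_cond big_pred0 ?add0r => [|u]; last first.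
    by rewrite lexE; lia.
  rewrite -{1}[w]add0n big_addn big_mkord; apply: eq_big => [u|u _].
    by rewrite lexE leq_addl.
  by rewrite addnC.
have le_ds : (des (x :: s) <= size s)%N by rewrite -ltnS des_lt.
rewrite des_cons2 comaj_cons2.
have -> : (p - v + (size s).+1 - ((x < c) + des (x :: s)).+1
           = p - w + (size s).+1 - (des (x :: s)).+1)%N by rewrite /w; lia.
rewrite -qbinom_hockey // mulr_sumr; apply: eq_bigr => i _.
rewrite IHs; last by case: i => /=; lia.
rewrite subnDA !mulrA -!exprD; congr ('X^_ * _).
by rewrite /w; lia.
Qed.

End Biwords.

(** Counterpart of [shuffles] on plain words, recursive on the first letter like [biword_gf]. The
    inner fixpoint is there because each call shortens only one of the two words. *)
Fixpoint shuf (s : seq nat) : seq nat -> seq (seq nat) :=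
  if s is x :: s' then
    fix shuf_s (t : seq nat) :=
      if t is y :: t' then map (cons x) (shuf s' t) ++ map (cons y) (shuf_s t')
      else [:: s]
  else fun t => [:: t].

Lemma shufs0 s : shuf s [::] = [:: s].
Proof. by case: s. Qed.

Lemma shuf_cons x s y t : shuf (x :: s) (y :: t) =
  map (cons x) (shuf s (y :: t)) ++ map (cons y) (shuf (x :: s) t).
Proof. by []. Qed.

Lemma lex_leNge (a b : nat * nat) : a.2 != b.2 -> lex_le b a = ~~ lex_le a b.
Proof. rewrite /lex_le; lia. Qed.

Lemma lex_le_trans : transitive lex_le.
Proof. move=> b a c; rewrite /lex_le; lia. Qed.

(** Compare the first biletters (i, x) and (j, y): as x and y differ, exactly one precedes the
    other, and it comes first in the merged word. The two cases are the shuffles starting with x and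
    those starting with y. *)
Lemma biword_gfM p a s t : ~~ has [in t] s ->
  biword_gf p a s * biword_gf p a t = \sum_(u <- shuf s t) biword_gf p a u.
Proof.
elim: s a t => [|x s IHs] a t /=; first by rewrite big_seq1 mul1r.
elim: t a => [|y t IHt] a dj; first by rewrite big_seq1 mulr1.
rewrite -[X in \sum_(_ <- X) _]/(_ ++ _) big_cat !big_map /=.
rewrite [X in _ = X + _]exchange_big [X in _ = _ + X]exchange_big /=.
have x_t : x \notin y :: t by move: dj; rewrite negb_or => /andP[].
have dj_s : ~~ has [in y :: t] s by move: dj; rewrite negb_or => /andP[].
have dj_t : ~~ has [in t] (x :: s).
  apply/hasPn => z zs; move/hasPn: (dj : ~~ has [in y :: t] (x :: s)).
  by move=> /(_ z zs); rewrite inE negb_or => /andP[].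
have neq_xy : x != y by move: x_t; rewrite inE negb_or => /andP[].
rewrite big_distrlr /=.
(* By induction, the shuffles starting with x leave a product of two factors; the factor of [y :: t]
   is expanded over the value of y. *)
under [X in _ = X + _]eq_bigr => u au.
  rewrite -mulr_sumr -IHs //= [biword_gf p (_, _) s * _]mulrC mulr_suml mulr_sumr.
over.
under [X in _ = _ + X]eq_bigr => w aw.
  rewrite -mulr_sumr -IHt //= mulr_suml mulr_sumr.
over.
rewrite [X in _ = _ + X](exchange_big_dep xpredT) //=.
rewrite big_mkcond [X in _ = X + _]big_mkcond -big_split; apply: eq_bigr => i _ /=.
(* If a does not precede (i, x), no (j, y) lies between them, by transitivity. *)
case: ifP => ai; last first.
  rewrite add0r big_pred0 // => j; apply/negP => /andP[aj /(lex_le_trans aj)].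
  by rewrite ai.
rewrite (bigID (fun j : 'I_p => lex_le (i : nat, x) (j : nat, y))) /=; congr (_ + _).
  apply: eq_big => [j|j _]; last by ring.
  by apply/andb_idl => /(lex_le_trans ai).
apply: eq_big => [j|j _]; last by ring.
by rewrite -lex_leNge // eq_sym.
Qed.

Lemma mem_shuf_sub s t u : u \in shuf s t ->
  [/\ perm_eq u (s ++ t), subseq s u & subseq t u].
Proof.
elim: s t u => [|x s IHs] t u /=.
  by rewrite inE => /eqP->; rewrite perm_refl subseq_refl sub0seq.
elim: t u => [|y t IHt] u.
  by rewrite inE => /eqP->; rewrite cats0 perm_refl subseq_refl.
rewrite mem_cat => /orP[] /mapP[v vS ->].
  have [p s1 s2] := IHs _ _ vS; rewrite [_ ++ _]/= perm_cons p /= eqxx s1.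
  split=> //; case: (y == x) => //.
  exact: subseq_trans (subseq_cons _ _) s2.
have [p s1 s2] := IHt _ vS; split.
- by rewrite perm_sym -[y :: t]cat1s -cat_cons perm_catCA /= perm_cons perm_sym.
- rewrite /=; case: (x == y) => //; exact: subseq_trans (subseq_cons _ _) s1.
- by rewrite /= eqxx.
Qed.

Lemma sub_mem_shuf s t u : uniq (s ++ t) -> size u = (size s + size t)%N ->
  subseq s u -> subseq t u -> u \in shuf s t.
Proof.
elim: u s t => [|z u IHu] s t Ust; first by case: s t Ust => [|x s] [|y t].
move=> sz ss st.
case: s Ust sz ss => [|x s] Ust sz ss.
  rewrite inE eq_sym; have := size_subseq_leqif st; rewrite sz add0n => -[_ <-].
  by rewrite eqxx.
case: t Ust sz st => [|y t] Ust sz st.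
  rewrite shufs0 inE eq_sym; have := size_subseq_leqif ss.
  by rewrite sz addn0 => -[_ <-]; rewrite eqxx.
rewrite shuf_cons mem_cat.
have x_t : x \notin y :: t.
  by move: Ust => /= /andP[]; rewrite mem_cat negb_or => /andP[].
have neq_xy : x != y by move: x_t; rewrite inE negb_or => /andP[].
case: (eqVneq x z) sz ss st => [<-|neq_xz] sz ss st.
  apply/orP; left; rewrite mem_map; last by move=> ? ? [].
  apply: IHu; first by case/andP: Ust.
  - by case: sz.
  - by move: ss; rewrite /= eqxx.
  - by move: st; rewrite /= eq_sym (negPf neq_xy).
case: (eqVneq y z) sz ss st => [<-|neq_yz] sz ss st.
  apply/orP; right; rewrite mem_map; last by move=> ? ? [].
  apply: IHu.
  - move: Ust; rewrite -cat1s -[y :: t]cat1s uniq_catCA => /andP[_].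
    by [].
  - by case: sz; rewrite addnS.
  - by move: ss; rewrite /= (negPf neq_xy).
  - by move: st; rewrite /= eqxx.
(* Otherwise u starts with neither x nor y, and both words would fit in its tail, which is one
   letter too short. *)
have : (size ((x :: s) ++ y :: t) <= size u)%N.
  apply: uniq_leq_size => // w.
  move: ss st; rewrite /= (negPf neq_xz) (negPf neq_yz).
  move=> /mem_subseq ss /mem_subseq st.
  by rewrite -cat_cons mem_cat => /orP[/ss|/st].
by rewrite size_cat -sz ltnn.
Qed.

Lemma uniq_shuf s t : uniq (s ++ t) -> uniq (shuf s t).
Proof.
elim: s t => [|x s IHs] t //; elim: t => [|y t IHt] // Ust.
have x_t : x \notin y :: t.
  by move: Ust => /= /andP[]; rewrite mem_cat negb_or => /andP[].
have neq_xy : x != y by move: x_t; rewrite inE negb_or => /andP[].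
rewrite shuf_cons cat_uniq !map_inj_uniq; try by move=> ? ? [].
rewrite IHs /=; last by case/andP: Ust.
rewrite IHt ?andbT; last first.
  by move: Ust; rewrite -[y :: t]cat1s uniq_catCA => /andP[_].
apply/hasPn => _ /mapP[v _ ->]; apply/mapP => -[w _ [E _]].
by rewrite E eqxx in neq_xy.
Qed.

Lemma disjoint_uniq_cat (pi sigma : permutation) : disjoint_perm pi sigma ->
  uniq (letters pi ++ letters sigma).
Proof.
move=> dj; have [/andP[Upi _] /andP[Usg _]] := (permutationP pi, permutationP sigma).
by rewrite cat_uniq Upi Usg andbT has_sym.
Qed.

Lemma shuffles_shuf (pi sigma : permutation) : disjoint_perm pi sigma ->
  perm_eq [seq letters tau | tau <- shuffles pi sigma] (shuf pi sigma).
Proof.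
move=> dj; have U := disjoint_uniq_cat dj; apply: uniq_perm.
- by rewrite map_inj_uniq ?uniq_shuffles //; exact: val_inj.
- exact: uniq_shuf.
move=> u; apply/mapP/idP => [[tau tauS ->]|uS].
  move: tauS; rewrite mem_shuffles // => /and3P[/eqP sz s1 s2].
  exact: sub_mem_shuf.
have [p s1 s2] := mem_shuf_sub uS.
have Pu : uniq u && (0%N \notin u).
  rewrite (perm_uniq p) U (perm_mem p) mem_cat negb_or /=.
  by case/andP: (permutationP pi) (permutationP sigma) => _ -> /andP[].
exists (Permutation Pu) => //; rewrite mem_shuffles //=.
by rewrite (perm_size p) size_cat eqxx s1.
Qed.

(** The value at p of the coefficient of x^|pi| in the image of pi under the first map. *)
Definition perm_weight (pi : permutation) (p : nat) : {poly rat} :=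
  'X^(comaj pi) * qbinom (p + size pi - (des pi).+1) (size pi).

(** The start (0, 0) imposes no constraint: 0 is below every letter, so putting it in front creates
    no descent. *)
Lemma perm_weightE pi p : perm_weight pi p = biword_gf p (0%N, 0%N) pi.
Proof.
rewrite /perm_weight; case: (letters pi) => [|x s].
  by rewrite /= qbinom0 /comaj big_nil mulr1.
case: p => [|p]; first by rewrite [RHS]big_ord0 qbinom_gt ?mulr0 //=; lia.
by rewrite biword_gfE // mul0n subn0 des_cons2 comaj_cons2 ltn0.
Qed.

Lemma perm_weightM pi sigma p : disjoint_perm pi sigma ->
  perm_weight pi p * perm_weight sigma p
  = \sum_(tau <- shuffles pi sigma) perm_weight tau p.
Proof.
move=> dj; under eq_bigr => tau _ do rewrite perm_weightE.
rewrite -(big_map letters xpredT (biword_gf p (0%N, 0%N))).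
by rewrite (perm_big _ (shuffles_shuf dj)) -biword_gfM // !perm_weightE.
Qed.

(** * Linear independence and shuffle-compatibility *)

(* Evaluating at p = j + 1 kills the terms of index > j and leaves A j as the
   coefficient of index j. *)
Lemma qbinom_indep n (A : nat -> {poly rat}) :
  (forall p, \sum_(j < n.-1.+1) A j * qbinom (p + n - j.+1) n = 0) ->
  forall j, (j <= n.-1)%N -> A j = 0.
Proof.
move=> A0; elim/ltn_ind => j IHj le_jn.
have := A0 j.+1; rewrite (bigD1 (Ordinal (le_jn : (j < n.-1.+1)%N))) //=.
rewrite addKn qbinomnn mulr1 big1 ?addr0 // => i /eqP neq_ij.
have [lt_ij|] := ltnP i j; first by rewrite IHj ?mul0r // -ltnS.
rewrite leq_eqVlt => /predU1P[E|lt_ji]; first by case: neq_ij; exact/val_inj.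
by rewrite qbinom_gt ?mulr0 //; case: i lt_ji {neq_ij} => i /=; lia.
Qed.

(** Group the terms by first index j into polynomials A_j, which vanish by [qbinom_indep], then read
    off a coefficient of A_j. Pairs may repeat in the family, so that multisets can be compared. *)
Lemma qbinom_sum_indep (I : Type) (r : seq I) (P : pred I) (c : I -> rat)
    (w : I -> nat * nat) n :
  (forall i, P i -> (w i).1 <= n.-1)%N ->
  (forall p, \sum_(i <- r | P i)
     c i *: ('X^((w i).2) * qbinom (p + n - (w i).1.+1) n) = 0) ->
  forall x, \sum_(i <- r | P i && (w i == x)) c i = 0.
Proof.
move=> le_wn S0 x; case: (leqP x.1 n.-1) => [le_xn|lt_nx]; last first.
  rewrite big_pred0 // => i; apply/negP => /andP[/le_wn le_wi /eqP E].
  by rewrite E leqNgt lt_nx in le_wi.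
pose A j := \sum_(i <- r | P i && ((w i).1 == j)) c i *: 'X^((w i).2).
have Ax0 : A x.1 = 0.
  apply: (@qbinom_indep n) => // p; rewrite -[RHS](S0 p).
  under eq_bigr => j _ do rewrite mulr_suml.
  rewrite (exchange_big_dep P) /= => [|j i _ /andP[] //].
  apply: eq_bigr => i Pi; rewrite (big_pred1 (Ordinal (le_wn _ Pi : (_ < n.-1.+1)%N))).
    by rewrite scalerAl.
  by move=> j; rewrite Pi /= -val_eqE /= eq_sym.
move/(congr1 (fun q : {poly rat} => q`_x.2)): Ax0.
rewrite coef0 coef_sum => E.
rewrite -[RHS]E big_mkcond [RHS]big_mkcond.
apply: eq_bigr => i _; rewrite coefZ coefXn -pair_eqE /= [x.2 == _]eq_sym.
by case: (P i) ((w i).1 == x.1) ((w i).2 == x.2) => [] [] []; rewrite ?mulr1 ?mulr0.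
Qed.

Lemma des_le (pi : permutation) : (des pi <= (size pi).-1)%N.
Proof. by case: (letters pi) => [|x s] //; rewrite -ltnS des_lt. Qed.

Lemma size_shuffles pi sigma tau : disjoint_perm pi sigma ->
  tau \in shuffles pi sigma -> size tau = (size pi + size sigma)%N.
Proof. by move=> dj; rewrite mem_shuffles // => /and3P[/eqP]. Qed.

Lemma eq_perm_weight (pi sigma : permutation) p : size pi = size sigma ->
  des_comaj pi = des_comaj sigma -> perm_weight pi p = perm_weight sigma p.
Proof. by move=> E [ED EC]; rewrite /perm_weight E ED EC. Qed.

(** The two lists of shuffles have equal total weight at every p, both being the same product;
    independence then forces equal multiplicities. *)
Lemma des_comaj_shuffle_compatible : shuffle_compatible des_comaj.
Proof.
move=> pi sigma pi' sigma' dj dj' Epi Esg Spi Ssg.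
pose n := (size pi + size sigma)%N.
(* One signed family: the tag [true] carries the sign +1, the tag [false] the sign -1. *)
pose r := [seq (true, tau) | tau <- shuffles pi sigma]
       ++ [seq (false, tau) | tau <- shuffles pi' sigma'].
pose P (i : bool * permutation) := size i.2 == n.
have H := @qbinom_sum_indep _ r P (fun i => (-1) ^+ (~~ i.1))
            (fun i => des_comaj i.2) n.
have szP : {in r, forall i, P i}.
  move=> i; rewrite mem_cat => /orP[] /mapP[tau tauS ->]; rewrite /P /=.
    by rewrite (size_shuffles dj).
  by rewrite (size_shuffles dj') // -Epi -Esg.
have {}H : forall x, \sum_(i <- r | des_comaj i.2 == x) (-1) ^+ (~~ i.1) = 0 :> rat.
  move=> x; rewrite -[RHS](H _ _ x).
  - rewrite big_seq_cond [RHS]big_seq_cond; apply: eq_bigl => i.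
    by case ir: (i \in r) => //=; rewrite szP.
  - by move=> i /eqP <-; exact: des_le.
  move=> p; transitivity (\sum_(i <- r) (-1) ^+ (~~ i.1) *: perm_weight i.2 p).
    rewrite big_seq_cond [RHS]big_seq_cond; apply: eq_big => i.
      by case ir: (i \in r) => //=; rewrite szP.
    by move=> /andP[_ /eqP <-].
  rewrite big_cat !big_map /= expr0 expr1.
  rewrite (eq_bigr _ (fun tau _ => scale1r _)) (eq_bigr _ (fun tau _ => scaleN1r _)).
  rewrite sumrN -!perm_weightM //.
  by rewrite (eq_perm_weight p Epi Spi) (eq_perm_weight p Esg Ssg) subrr.
apply/allP => x _; apply/eqP; move: (H x).
rewrite big_cat !big_map /= expr0 expr1 !big_const_seq.
rewrite !iter_addr !addr0 mulNrn => /eqP.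
by rewrite subr_eq0 Num.Theory.eqr_nat !count_map => /eqP.
Qed.

(** * Morphisms out of a shuffle algebra *)

(** Here [phi] is only linear, since this serves to build the ring morphism. *)
Lemma linear_comb_mul (A B : algType rat) (phi : {linear A -> B}) (I : Type)
    (e : I -> A) (r s : seq I) (c d : I -> rat) :
  (forall i j, phi (e i * e j) = phi (e i) * phi (e j)) ->
  phi ((\sum_(i <- r) c i *: e i) * \sum_(j <- s) d j *: e j)
  = phi (\sum_(i <- r) c i *: e i) * phi (\sum_(j <- s) d j *: e j).
Proof.
move=> phiM; rewrite mulr_suml !linear_sum mulr_suml; apply: eq_bigr => i _.
rewrite mulr_sumr linear_sum mulr_sumr; apply: eq_bigr => j _.
by rewrite -scalerAl -scalerAr !linearZ -scalerAl -scalerAr /= phiM.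
Qed.

Section BasisMorphism.
Context {V : eqType} {st : statistic V} (Hst : shuffle_compatible st).

Lemma shuffle_basisE (f : shuffle_algebra Hst) :
  f = \sum_(k <- msupp (f : {malg rat[st_class st]}))
        (f : {malg rat[st_class st]})@_k *: shuffle_basis Hst (repr k).
Proof.
rewrite {1}[f]malg_basisE; apply: eq_bigr => k _.
by rewrite /shuffle_basis class_of_repr.
Qed.

(** Multiplicativity on disjoint pairs suffices, since any two classes have disjoint
    representatives. *)
Lemma shuffle_lrmorphism (B : algType rat) (F : permutation -> B) :
  (forall pi sigma : permutation,
     size pi = size sigma -> st pi = st sigma -> F pi = F sigma) ->
  F perm_nil = 1 ->
  (forall pi sigma, disjoint_perm pi sigma ->
     F pi * F sigma = \sum_(tau <- shuffles pi sigma) F tau) ->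
  exists phi : {lrmorphism shuffle_algebra Hst -> B},
    forall pi, phi (shuffle_basis Hst pi) = F pi.
Proof.
move=> F_class F1 FM.
pose phi0 : shuffle_algebra Hst -> B := malg_lin (fun k : st_class st => F (repr k)).
have phiE pi : phi0 (shuffle_basis Hst pi) = F pi.
  rewrite /phi0 /shuffle_basis malg_linU.
  have /eqP/class_ofP[] : class_of st (repr (class_of st pi)) = class_of st pi.
    exact: class_of_repr.
  exact: F_class.
have phi_lin : linear phi0 by exact: malg_lin_linear.
pose lm := GRing.isLinear.Build rat (shuffle_algebra Hst) B *:%R phi0 phi_lin.
pose phi1 : {linear shuffle_algebra Hst -> B} := HB.pack phi0 lm.
have basisM pi sigma : phi1 (shuffle_basis Hst pi * shuffle_basis Hst sigma)
    = phi1 (shuffle_basis Hst pi) * phi1 (shuffle_basis Hst sigma).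
  (* Replace sigma by a shifted copy in the same class, disjoint from pi. *)
  have [tau dj ->] : exists2 tau, disjoint_perm pi tau
      & shuffle_basis Hst sigma = shuffle_basis Hst tau.
    exists (shift (max_letter pi) sigma); first exact: shift_disjoint_perm.
    by apply/shuffle_basis_eq; rewrite stat_shift size_map.
  rewrite shuffle_basisM // linear_sum /= !phiE FM //.
  by apply: eq_bigr => rho _; exact: phiE.
have phi_mul : monoid_morphism phi0.
  split=> [|f g]; first by rewrite -shuffle_basis1 phiE.
  rewrite (shuffle_basisE f) (shuffle_basisE g).
  by apply: (linear_comb_mul (phi := phi1)) => k l; exact: basisM.
pose mm := GRing.isMonoidMorphism.Build _ _ phi0 phi_mul.
pose phi : {lrmorphism shuffle_algebra Hst -> B} := HB.pack phi0 lm mm.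
by exists phi.
Qed.

Lemma linear_shuffle_basisE (W : lmodType rat) (phi : {linear shuffle_algebra Hst -> W})
    (F : permutation -> W) (f : shuffle_algebra Hst) :
  (forall pi, phi (shuffle_basis Hst pi) = F pi) ->
  phi f = \sum_(k <- msupp (f : {malg rat[st_class st]}))
            (f : {malg rat[st_class st]})@_k *: F (repr k).
Proof.
move=> phiE; rewrite {1}(shuffle_basisE f) linear_sum; apply: eq_bigr => k _.
by rewrite linearZ phiE.
Qed.

Lemma range_linear (W : lmodType rat) (phi : {linear shuffle_algebra Hst -> W})
    (F : permutation -> W) :
  (forall pi, phi (shuffle_basis Hst pi) = F pi) -> range phi = lin_span (range F).
Proof.
move=> phiE; apply/seteqP; split=> [_ [f _ <-]|_ [n [c [b [bS ->]]]]].
  rewrite (linear_shuffle_basisE f phiE) (big_nth (class_of st perm_nil)) big_mkord.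
  eexists; eexists; eexists; split; last by reflexivity.
  by move=> i; eexists.
have /choice[g gE] : forall i, exists f, phi f = b i.
  by move=> i; have [pi _ <-] := bS i; exists (shuffle_basis Hst pi).
exists (\sum_(i < n) c i *: g i) => //.
by rewrite linear_sum; apply: eq_bigr => i _; rewrite linearZ gE.
Qed.

(** Yields the subalgebra claims, each span being the range of a morphism. *)
Lemma range_subalg_closed (B : algType rat)
    (phi : {lrmorphism shuffle_algebra Hst -> B}) :
  GRing.subalg_closed (mem (range phi)).
Proof.
split=> [|a x y|x y].
- by rewrite inE; exists 1; rewrite ?rmorph1.
- rewrite !inE => -[f _ <-] [g _ <-]; exists (a *: f + g) => //.
  by rewrite linearP.
- rewrite !inE => -[f _ <-] [g _ <-]; exists (f * g) => //.
  by rewrite rmorphM.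
Qed.

End BasisMorphism.

(** * Generating functions in t *)

(** Carries the identities on [perm_weight] from Q[q] into Q[[q]]. *)
Definition fps_of_poly (R : nzRingType) (q : {poly R}) : {fps R} := Fps (fun n => q`_n).

Section FpsOfPoly.
Variable R : nzRingType.

Fact fps_of_poly_linear : linear (@fps_of_poly R).
Proof. by move=> a q r; apply/fpsP => n /=; rewrite coefD coefZ. Qed.

Fact fps_of_poly_monoid : monoid_morphism (@fps_of_poly R).
Proof. by split=> [|q r]; apply/fpsP => n /=; rewrite ?coef1 ?coefM. Qed.

HB.instance Definition _ :=
  GRing.isLinear.Build R {poly R} {fps R} *:%R (@fps_of_poly R) fps_of_poly_linear.
HB.instance Definition _ :=
  GRing.isMonoidMorphism.Build {poly R} {fps R} (@fps_of_poly R) fps_of_poly_monoid.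

Lemma fps_of_poly_inj : injective (@fps_of_poly R).
Proof.
by move=> q r /(congr1 (@fps_coef R)) E; apply/polyP => n; exact: (congr1 (@^~ n) E).
Qed.

Lemma fps_of_polyX : fps_of_poly ('X : {poly R}) = fpsX.
Proof. by apply/fpsP => n /=; rewrite coefX. Qed.

Lemma coef_fpsB (f g : {fps R}) n : fps_coef (f - g) n = fps_coef f n - fps_coef g n.
Proof. by []. Qed.

Lemma coef_fpsCM (c : R) (f : {fps R}) n : fps_coef (fpsC c * f) n = c * fps_coef f n.
Proof.
rewrite [LHS]big_ord_recl /= subn0 big1 ?addr0 // => i _.
by rewrite mul0r.
Qed.

Lemma coef_fpsXM (f : {fps R}) n :
  fps_coef (fpsX * f) n = if n is m.+1 then fps_coef f m else 0.
Proof.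
rewrite [LHS]big_ord_recl /= mul0r add0r; case: n => [|n]; first by rewrite big_ord0.
rewrite big_ord_recl /= mul1r subn1 big1 ?addr0 // => i _.
by rewrite mul0r.
Qed.

Lemma coef_fpsXnM (f : {fps R}) k n :
  fps_coef (fpsX ^+ k * f) n = if (k <= n)%N then fps_coef f (n - k) else 0.
Proof.
elim: k n => [|k IHk] n; first by rewrite expr0 mul1r subn0.
by rewrite exprS -mulrA coef_fpsXM; case: n => // n; rewrite IHk subSS ltnS.
Qed.

Lemma fpsC_X k (c : R) : fpsC (c ^+ k) = fpsC c ^+ k.
Proof.
elim: k => [|k IHk]; first by apply/fpsP => n /=; case: eqP.
rewrite !exprS -IHk; apply/fpsP => n.
by rewrite coef_fpsCM /=; case: eqP; rewrite ?mulr0.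
Qed.

End FpsOfPoly.

(** By the q-Pascal rule, multiplying the series for n + 1 by its last factor 1 - q^(n+1) t gives
    the series for n. *)
Lemma qbinom_gf n :
  (Fps (fun m => fps_of_poly (qbinom (m + n) n)) : tq_fps)
  * \prod_(0 <= i < n.+1) (1 - qvar ^+ i * tvar) = 1.
Proof.
elim: n => [|n IHn].
  rewrite big_nat1 expr0 mul1r mulrBr mulr1 mulrC; apply/fpsP => m.
  rewrite coef_fpsB coef_fpsXM; case: m => [|m].
    by rewrite subr0 [LHS]/= qbinom0 rmorph1.
  by rewrite [fps_coef (Fps _) _]/= [fps_coef (Fps _) _]/= !qbinom0 subrr.
rewrite big_nat_recr //= mulrCA mulrC -[RHS]IHn; congr (_ * _).
rewrite mulrBr mulr1 mulrCA -fpsC_X [_ * tvar]mulrC; apply/fpsP => m.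
rewrite coef_fpsB coef_fpsCM coef_fpsXM; case: m => [|m].
  by rewrite mulr0 subr0 /= !qbinomnn.
rewrite [fps_coef (Fps _) _]/= [fps_coef (Fps _) _]/= [RHS]/=.
rewrite -fps_of_polyX -rmorphXn -rmorphM -rmorphB.
by rewrite addnS qbinomS -addSnnS addrK.
Qed.

Lemma tq_fraction_coef k j n : (0 < n)%N ->
  to_hadamard (qvar ^+ k * tvar ^+ (j + 1)
               / \prod_(0 <= i < n.+1) (1 - qvar ^+ i * tvar))
  = (fun p => fps_of_poly ('X^k * qbinom (p + n - j.+1) n)).
Proof.
move=> n_gt0; have /mulr1_eq -> := etrans (mulrC _ _) (qbinom_gf n).
apply/funext => p; rewrite addn1 -mulrA -fpsC_X /to_hadamard.
rewrite coef_fpsCM coef_fpsXnM rmorphM rmorphXn /= fps_of_polyX; congr (_ * _).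
case: ltnP => [lt_jp|le_pj]; first by rewrite /= addnBAC.
(* For p <= j the upper index, even truncated, is below n because n > 0. *)
by rewrite qbinom_gt ?rmorph0 //; lia.
Qed.

(** All coefficients of 1/(1-t) are 1, which is the unit of the Hadamard product. *)
Lemma tq_const1 : tq_const = 1.
Proof.
have := qbinom_gf 0; rewrite big_nat1 expr0 mul1r => /(etrans (mulrC _ _))/mulr1_eq E.
rewrite /tq_const mul1r E -[RHS]polyC1; congr (_%:P); apply/funext => p.
by rewrite /to_hadamard /= qbinom0 rmorph1.
Qed.

(** * Polynomials in x and the injectivity criterion *)

Section Monomials.
Variable A : comAlgType rat.

(** The power of x records the length, which is constant on the shuffles. [A] is generic in order to
    serve both target algebras. *)
Lemma monomial_shuffleM (g : permutation -> A) pi sigma : disjoint_perm pi sigma ->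
  g pi * g sigma = \sum_(tau <- shuffles pi sigma) g tau ->
  ((g pi)%:P * 'X^(size pi)) * ((g sigma)%:P * 'X^(size sigma))
  = \sum_(tau <- shuffles pi sigma) ((g tau)%:P * 'X^(size tau) : polyalg A).
Proof.
move=> dj gM; rewrite mulrACA -polyCM -exprD gM rmorph_sum mulr_suml.
rewrite big_seq [RHS]big_seq; apply: eq_bigr => tau tauS.
by rewrite (size_shuffles dj tauS).
Qed.

Lemma coef_polyalgZ (c : rat) (q : polyalg A) n :
  (c *: q : {poly A})`_n = c *: (q : {poly A})`_n.
Proof. by rewrite [LHS]coefCM mulr_algl. Qed.

Lemma coef_sum_monomial (I : Type) (r : seq I) (c : I -> rat)
    (a : I -> A) (m : I -> nat) n :
  ((\sum_(i <- r) c i *: ((a i)%:P * 'X^(m i) : polyalg A)) : {poly A})`_n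
  = \sum_(i <- r | m i == n) c i *: a i.
Proof.
rewrite coef_sum [RHS]big_mkcond; apply: eq_bigr => i _.
rewrite coef_polyalgZ coefCM coefXn eq_sym.
by case: eqP; rewrite ?mulr1 ?mulr0 ?scaler0.
Qed.

End Monomials.

Local Notation class := (st_class des_comaj).

(** Injectivity of both maps reduces to this, by extracting coefficients. *)
Lemma perm_weight_indep (f : {malg rat[class]}) :
  (forall n p, \sum_(k <- msupp f | size (repr k) == n)
     f@_k *: perm_weight (repr k) p = 0) -> f = 0.
Proof.
move=> f0; apply/malgP => k0; rewrite mcoeff0.
case: (boolP (k0 \in msupp f)) => [k0f|]; last by move/mcoeff_outdom.
have := @qbinom_sum_indep _ (msupp f) (fun k : class => size (repr k) == size (repr k0))
  (fun k => f@_k) (fun k => des_comaj (repr k)) (size (repr k0)) _ _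
  (des_comaj (repr k0)).
move=> <- //; last 2 first.
- by move=> k /eqP <-; exact: des_le.
- move=> p; rewrite -[RHS](f0 (size (repr k0)) p).
  by apply: eq_bigr => k /eqP <-.
(* Length and pair determine the class, so only [k0] is left in the sum. *)
rewrite (eq_bigl (pred1 k0)) => [|k /=].
  rewrite -big_filter (perm_big [:: k0]) ?big_seq1 //.
  apply: uniq_perm; rewrite ?filter_uniq ?fset_uniq // => k.
  by rewrite mem_filter mem_seq1 /=; case: (eqVneq k k0) => [->|].
apply/andP/eqP => [[/eqP Es /eqP Ew]|->]; last by rewrite !eqxx.
by rewrite -(class_of_repr k) -(class_of_repr k0); apply/eqP/class_ofP.
Qed.

(** * Attained values of (des, comaj) *)

Lemma binS2 j : ('C(j.+1 + 1, 2) = 'C(j + 1, 2) + j.+1)%N.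
Proof. by rewrite addSn binS bin1 addn1. Qed.

(** Doubling makes the triangular number a product that the arithmetic tactics can handle. *)
Lemma double_binS2 j : ('C(j + 1, 2).*2 = j * j.+1)%N.
Proof. by elim: j => [|j IHj] //; rewrite binS2 doubleD IHj; nia. Qed.

Definition des_comaj_range (n : nat) (jk : nat * nat) : bool :=
  (jk.1 <= n - 1)%N && ('C(jk.1 + 1, 2) <= jk.2 <= n * jk.1 - 'C(jk.1 + 1, 2))%N.

(** comaj adds j distinct weights from 1, ..., n-1: at least 1 + ... + j, at most (n-1) + ... +
    (n-j). The proof prepends one letter at a time. *)
Lemma des_comajP (pi : permutation) : (0 < size pi)%N ->
  des_comaj_range (size pi) (des_comaj pi).
Proof.
rewrite /des_comaj_range /=; case: (letters pi) => // x s _.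
elim: s x => [|y s IHs] x; first by rewrite /comaj big_nil.
move/(_ y): IHs; rewrite des_cons2 comaj_cons2 [size (x :: _)]/= [size (y :: s)]/=.
set j := des _; set k := comaj _; set n := size s.
have := double_binS2 j; have := binS2 j.
case: (y < x)%N; rewrite ?mul1n ?mul0n ?add0n ?add1n; nia.
Qed.

(** The alternatives are the two ways to prepend a letter to a word of length n: without a descent,
    or with one of weight n. *)
Lemma des_comaj_range_pred n j k : (0 < n)%N -> des_comaj_range n.+1 (j, k) ->
  des_comaj_range n (j, k)
  \/ exists j' k', [/\ j = j'.+1, k = (n + k')%N & des_comaj_range n (j', k')].
Proof.
move=> n_gt0 Rjk; case: (boolP (des_comaj_range n (j, k))) => [|nR]; first by left.
right; move: Rjk nR; rewrite /des_comaj_range /=; case: j => [|j] Rjk nR.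
  by move: Rjk nR; rewrite muln0; lia.
exists j, (k - n)%N; have := double_binS2 j; move: (binS2 j) Rjk nR => ->.
by move=> /andP[le_jn /andP[le_k ge_k]] nR T; split; rewrite //=; nia.
Qed.

Lemma exists_perm_des_comaj n jk : (0 < n)%N -> des_comaj_range n jk ->
  exists2 pi : permutation, size pi = n & des_comaj pi = jk.
Proof.
case: n => // n _; elim: n jk => [|n IHn] [j k] Rjk.
  have P1 : uniq [:: 1%N] && (0%N \notin [:: 1%N]) by [].
  exists (Permutation P1) => //=.
  move: Rjk; rewrite /des_comaj_range /= leqn0 => /andP[/eqP-> ].
  rewrite muln0 /= leqn0 => /eqP->.
  by rewrite /comaj /des /descents /= big_nil.
have [//|Rn|[j' [k' [-> -> Rn]]]] := des_comaj_range_pred _ Rjk.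
  (* No new descent: shift all letters up and put 1 in front. *)
  have [pi szpi [dpi cpi]] := IHn _ Rn; pose sg := shift 1 pi.
  have [dsg csg] : des sg = j /\ comaj sg = k.
    by have [] := des_comaj_order (shift_same_order 1 pi); rewrite dpi cpi.
  have P1 : uniq (1%N :: sg) && (0%N \notin 1%N :: sg).
    have /andP[U Z] := permutationP sg; rewrite cons_uniq U inE (negPf Z) !andbT.
    apply/mapP => -[x xpi /eqP]; rewrite eqSS eq_sym => /eqP x0.
    by have /andP[_] := permutationP pi; rewrite -x0 xpi.
  exists (Permutation P1); first by rewrite /= size_map szpi.
  rewrite -[des_comaj _]/(des (1%N :: letters sg), comaj (1%N :: letters sg)).
  move: dsg csg; case E: (letters sg) => [|x s].
    by move: szpi; rewrite -(size_map (addn 1)) -[map _ _]/(letters sg) E.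
  have x_gt0 : (0 < x)%N.
    by have /andP[_] := permutationP sg; rewrite E inE negb_or lt0n eq_sym => /andP[].
  by rewrite des_cons2 comaj_cons2 ltnS leqNgt x_gt0 => -> ->.
(* New descent: put a letter larger than all others in front. *)
have [pi szpi [dpi cpi]] := IHn _ Rn.
have gt_max x : x \in letters pi -> (x < (max_letter pi).+1)%N.
  by move=> xpi; rewrite ltnS /max_letter (big_rem x) //= leq_maxl.
have P1 : uniq ((max_letter pi).+1 :: pi) && (0%N \notin (max_letter pi).+1 :: pi).
  have /andP[U Z] := permutationP pi; rewrite cons_uniq U inE (negPf Z) !andbT.
  by apply/negP => /gt_max; rewrite ltnn.
exists (Permutation P1); first by rewrite /= szpi.
rewrite -[des_comaj _]/(des (_ :: letters pi), comaj (_ :: letters pi)).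
move: szpi dpi cpi gt_max; case: (letters pi) => [|x s] // [szs] dpi cpi gt_max.
by rewrite des_cons2 comaj_cons2 dpi cpi gt_max ?mem_head // szs mul1n.
Qed.

Definition range_seq (n : nat) : seq (nat * nat) :=
  [seq (j, k) | j <- iota 0 n,
     k <- iota 'C(j + 1, 2) (n * j - 'C(j + 1, 2).*2).+1].

Lemma mem_range_seq n jk : (0 < n)%N -> (jk \in range_seq n) = des_comaj_range n jk.
Proof.
case: jk => j k n_gt0; apply/allpairsPdep/idP.
  move=> [j' [k' [+ + [-> ->]]]]; rewrite !mem_iota /des_comaj_range /= => lt_jn.
  have := double_binS2 j'.
  (* This makes the truncated subtraction in the interval length exact. *)
  have : (j' * j'.+1 <= n * j')%N by rewrite mulnC leq_mul2r; lia.
  lia.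
rewrite /des_comaj_range /= => R.
have T := double_binS2 j.
have le_jn : (j * j.+1 <= n * j)%N by rewrite mulnC leq_mul2r; lia.
have jn : j \in iota 0 n by rewrite mem_iota; lia.
have kn : k \in iota 'C(j + 1, 2) (n * j - 'C(j + 1, 2).*2).+1 by rewrite mem_iota; lia.
by exists j, k.
Qed.

Lemma uniq_range_seq n : uniq (range_seq n).
Proof.
apply: allpairs_uniq_dep => [|j _|]; try exact: iota_uniq.
by move=> [j k] [j' k'] _ _ /= [-> ->].
Qed.

(** From n to n + 1 the j-th term grows by j, in total by C(n, 2), and the new term j = n equals
    1. *)
Lemma size_range_seq n : size (range_seq n) = ('C(n, 3) + n)%N.
Proof.
have -> : size (range_seq n) = (\sum_(0 <= j < n) (n * j - j * j.+1).+1)%N.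
  rewrite size_allpairs_dep sumnE big_map /index_iota subn0; apply: eq_bigr => j _.
  by rewrite size_iota double_binS2.
elim: n => [|n IHn]; first by rewrite big_nil.
rewrite big_nat_recr //= [(n * n.+1)%N]mulnC subnn binS -bin2_sum.
suff -> : (\sum_(0 <= j < n) (n.+1 * j - j * j.+1).+1
  = \sum_(0 <= j < n) (n * j - j * j.+1).+1 + \sum_(0 <= j < n) j)%N by
  rewrite IHn; lia.
rewrite -big_split /= big_nat [RHS]big_nat; apply: eq_bigr => j /andP[_ lt_jn].
nia.
Qed.

(** Both spans have the same index set, hence the abstract [G]; [w0] is the image of the empty
    permutation. *)
Lemma range_perm_des_comaj (W : Type) (w0 : W) (G : nat -> nat -> nat -> W) :
  range (fun pi : permutation =>
    if (1 <= size pi)%N then G (comaj pi) (des pi) (size pi) else w0)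
  = [set w0] `|`
    [set f | exists n j k : nat,
       [/\ (1 <= n)%N, (j <= n - 1)%N,
           ('C(j + 1, 2) <= k <= n * j - 'C(j + 1, 2))%N & f = G k j n]].
Proof.
apply/seteqP; split=> [_ [pi _ <-]|f [->|[n [j [k [n_gt0 le_jn le_k ->]]]]]].
- case: ifP => [pi_gt0|_]; last by left.
  have /andP[le_des le_comaj] := des_comajP pi_gt0.
  by right; exists (size pi), (des pi), (comaj pi).
- by exists perm_nil.
- have [|pi szpi [dpi cpi]] := @exists_perm_des_comaj n (j, k) n_gt0.
    by rewrite /des_comaj_range /= le_jn.
  by exists pi => //; rewrite szpi n_gt0 dpi cpi.
Qed.

Lemma qbinom_fun_perm (pi : permutation) :
  qbinom_fun (comaj pi) (des pi) (size pi)
  = if (1 <= size pi)%N then qbinom_fun (comaj pi) (des pi) (size pi) else 1.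
Proof.
case: (letters pi) => [|x s] //=; apply/funext => p.
by rewrite /qbinom_fun qbinom0 /comaj big_nil expr0 !mulr1 polyC1.
Qed.

(** The coefficient of t^p is the first map evaluated at p, so the pointwise product in p becomes
    the Hadamard product in t. *)
Lemma tq_fraction_perm (pi : permutation) :
  (if (1 <= size pi)%N then tq_fraction (comaj pi) (des pi) (size pi) else tq_const)
  = ((fun p => fps_of_poly (perm_weight pi p)) : hadamard_tq)%:P * 'X^(size pi)
    :> tq_x_algebra.
Proof.
case: ltnP => [pi_gt0|]; first by rewrite /tq_fraction tq_fraction_coef.
rewrite tq_const1 /perm_weight leqn0 size_eq0 => /eqP->; rewrite expr0 mulr1.
rewrite -[LHS]polyC1; congr (_%:P); apply/funext => p.
by rewrite /= qbinom0 /comaj big_nil mulr1 rmorph1.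
Qed.

Lemma lin_indep_malgU (K : choiceType) (d : nat) (k : 'I_d -> K) :
  injective k -> lin_indep (fun i => << k i >> : {malg rat[K]}).
Proof.
move=> k_inj c c0 i; move/(congr1 (mcoeff (k i))): c0.
rewrite mcoeff0 raddf_sum (bigD1 i) //= mcoeffZ mcoeffUU mulr1 big1 ?addr0 // => j neq_ji.
by rewrite mcoeffZ mcoeffU (inj_eq k_inj) (negPf neq_ji) mulr0.
Qed.

(** * The two isomorphisms and the dimensions *)

Section DesComajAlgebra.
Variable Hsc : shuffle_compatible des_comaj.

Lemma des_comaj_qbinom_iso :
  exists phi : {lrmorphism shuffle_algebra Hsc -> (nat -> q_x_algebra)},
    [/\ forall pi : permutation,
          phi (shuffle_basis Hsc pi) = qbinom_fun (comaj pi) (des pi) (size pi),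
        injective phi
      & range phi = qbinom_span].
Proof.
have [pi sg sz [dE cE]|||phi phiE] := @shuffle_lrmorphism _ _ Hsc (nat -> q_x_algebra)
  (fun pi => qbinom_fun (comaj pi) (des pi) (size pi)).
- by rewrite sz dE cE.
- by rewrite qbinom_fun_perm.
- move=> pi sg dj; apply/funext => p; rewrite fct_sumE.
  exact: (monomial_shuffleM (g := perm_weight^~ p) dj (perm_weightM p dj)).
exists phi; split=> //.
(* Injectivity: evaluate at p and take the coefficient of x^n. *)
- apply: raddf_inj => f phif0; apply: perm_weight_indep => n p.
  have := etrans (esym (linear_shuffle_basisE f phiE)) phif0.
  move/(congr1 (@^~ p)); rewrite fct_sumE /= => /(congr1 (fun q : {poly _} => q`_n)).
  rewrite coef0 => E; rewrite -[RHS]E; apply/esym.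
  exact: (coef_sum_monomial _ _ (fun k => perm_weight (repr k) p)
                           (fun k => size (repr k)) n).
rewrite (range_linear (fun pi => etrans (phiE pi) (qbinom_fun_perm pi))).
by rewrite range_perm_des_comaj.
Qed.

Lemma des_comaj_tq_iso :
  exists phi : {lrmorphism shuffle_algebra Hsc -> tq_x_algebra},
    [/\ forall pi : permutation,
          phi (shuffle_basis Hsc pi)
          = (if (1 <= size pi)%N
             then tq_fraction (comaj pi) (des pi) (size pi) else tq_const),
        injective phi
      & range phi = tq_span].
Proof.
have [pi sg sz [dE cE]|||phi phiE] := @shuffle_lrmorphism _ _ Hsc tq_x_algebra
  (fun pi => if (1 <= size pi)%N
             then tq_fraction (comaj pi) (des pi) (size pi) else tq_const).
- by rewrite sz dE cE.
- exact: tq_const1.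
- move=> pi sg dj; under [RHS]eq_bigr => tau _ do rewrite tq_fraction_perm.
  rewrite !tq_fraction_perm.
  apply: (monomial_shuffleM
    (g := fun pi => (fun p => fps_of_poly (perm_weight pi p)) : hadamard_tq) dj).
  apply/funext => p; rewrite fct_sumE -rmorph_sum -(perm_weightM p dj).
  by rewrite rmorphM.
exists phi; split=> //.
(* Injectivity: take the coefficients of x^n and t^p, then return from Q[[q]] to Q[q]. *)
- apply: raddf_inj => f phif0; apply: perm_weight_indep => n p.
  have phiE' pi := etrans (phiE pi) (tq_fraction_perm pi).
  have := etrans (esym (linear_shuffle_basisE f phiE')) phif0.
  move/(congr1 (fun q : {poly hadamard_tq} => q`_n)); rewrite coef0.
  rewrite [X in X = _ -> _]coef_sum_monomial.
  move/(congr1 (@^~ p)); rewrite fct_sumE /= => E.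
  apply: fps_of_poly_inj; rewrite rmorph0 -[RHS]E rmorph_sum.
  by apply: eq_bigr => k _; apply/fpsP => m; rewrite /= coefZ.
by rewrite (range_linear phiE) range_perm_des_comaj.
Qed.

(** One permutation of length n for each attained pair gives a basis. *)
Lemma has_dim_homogeneous n : (1 <= n)%N ->
  has_dim (homogeneous Hsc n) ('C(n, 3) + n).
Proof.
move=> n_gt0; rewrite -size_range_seq.
pose rs := range_seq n.
have /choice[r rP] : forall i : 'I_(size rs), exists pi : permutation,
    size pi = n /\ des_comaj pi = nth (0, 0)%N rs i.
  move=> i; have [|pi] := @exists_perm_des_comaj n (nth (0, 0)%N rs i) n_gt0.
    by rewrite -mem_range_seq // mem_nth.
  by exists pi.
exists (fun i => shuffle_basis Hsc (r i)); split.
  apply: (@lin_indep_malgU _ _ (fun i => class_of des_comaj (r i))) => i j.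
  move=> /eqP/class_ofP[_]; rewrite (rP i).2 (rP j).2 => /eqP.
  by rewrite nth_uniq ?uniq_range_seq // => /eqP/val_inj.
congr lin_span; apply/seteqP; split=> [_ [pi szpi <-]|_ [i _ <-]]; last first.
  by exists (r i) => //; exact: (rP i).1.
have pi_rs : des_comaj pi \in rs.
  by rewrite mem_range_seq // -szpi des_comajP // szpi.
have lt_i : (index (des_comaj pi) rs < size rs)%N by rewrite index_mem.
exists (Ordinal lt_i); first by []; apply/shuffle_basis_eq.
by rewrite (rP _).1 (rP _).2 nth_index.
Qed.

End DesComajAlgebra.

Theorem theorem4p5 :
  exists Hsc : shuffle_compatible des_comaj,
    [/\ [/\ GRing.subalg_closed (mem qbinom_span)
          & exists phi : {lrmorphism shuffle_algebra Hsc -> (nat -> q_x_algebra)},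
            [/\ forall pi : permutation,
                  phi (shuffle_basis Hsc pi)
                  = qbinom_fun (comaj pi) (des pi) (size pi),
                injective phi
              & range phi = qbinom_span]],
        [/\ GRing.subalg_closed (mem tq_span)
          & exists phi : {lrmorphism shuffle_algebra Hsc -> tq_x_algebra},
            [/\ forall pi : permutation,
                  phi (shuffle_basis Hsc pi)
                  = (if (1 <= size pi)%N
                     then tq_fraction (comaj pi) (des pi) (size pi)
                     else tq_const),
                injective phi
              & range phi = tq_span]]
      & forall n : nat, (1 <= n)%N ->
          has_dim (homogeneous Hsc n) ('C(n, 3) + n)].
Proof.
exists des_comaj_shuffle_compatible; split; last exact: has_dim_homogeneous.
- have [phi [phiE phi_inj phi_range]] :=
    des_comaj_qbinom_iso des_comaj_shuffle_compatible.
  split; last by exists phi.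
  by rewrite -phi_range; exact: range_subalg_closed.
have [phi [phiE phi_inj phi_range]] :=
  des_comaj_tq_iso des_comaj_shuffle_compatible.
split; last by exists phi.
by rewrite -phi_range; exact: range_subalg_closed.
Qed.
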